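(* The strong total Weihrauch degrees $\mathcal{W}_{stW}$, ordered by $\le_{stW}$ with the operations $(f,g)\mapsto\overline f\sqcap\overline g$ and $(f,g)\mapsto f\boxplus g$, form a lattice, and this lattice is not distributive.
   Context: A represented space $(X,\delta_X)$ is a set with a surjective partial map $\delta_X:\subseteq\mathbb{N}^\mathbb{N}\to X$; problems are partial multi-valued maps between represented spaces; $F$ realizes $f:\subseteq X\rightrightarrows Y$ if $\delta_YF(p)\in f(\delta_X(p))$ for all $p\in\mathrm{dom}(f\circ\delta_X)$, totally if $F$ is total. A representation $\delta$ is precomplete if for every computable $F:\subseteq\mathbb{N}^\mathbb{N}\to\mathbb{N}^\mathbb{N}$ there is a total computable $G$ with $\delta F(p)=\delta G(p)$ for $p\in\mathrm{dom}(F)$. $f\le_{stW}g$ iff, after replacing the representations of all involved spaces by computably equivalent precomplete ones, there are computable $H,K:\subseteq\mathbb{N}^\mathbb{N}\to\mathbb{N}^\mathbb{N}$ such that for every total realizer $G$ of $g$, $HGK$ is a total realizer of $f$. $\mathcal W_{stW}$ is the set of $\equiv_{stW}$-classes. Completion: $p-1$ is the concatenation of $p(0)-1,p(1)-1,\dots$ with $0-1$ the empty word; $\delta_X^\wp(p)=\delta_X(p-1)$ if $p-1\in\mathrm{dom}(\delta_X)$; $\overline X=X\cup\{\bot\}$ with $\delta_{\overline X}(p)=\delta^\wp_X(p)$ if defined, $\bot$ otherwise; $\overline f(x)=f(x)$ on $\mathrm{dom}(f)$, $\overline Y$ otherwise. For $f:\subseteq X\rightrightarrows Y$, $g:\subseteq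 U\rightrightarrows V$: $(f\sqcap g)(x,u)=f(x)\sqcup g(u)$ on $\mathrm{dom}(f)\times\mathrm{dom}(g)$ with $A\sqcup B=(\{0\}\times A)\cup(\{1\}\times B)$; $f\boxplus g:\subseteq X\sqcup U\rightrightarrows\overline Y\times\overline V$ maps $(0,x)\mapsto f(x)\times\overline V$ and $(1,u)\mapsto\overline Y\times g(u)$ on $\mathrm{dom}(f)\sqcup\mathrm{dom}(g)$. *)

(* Defs.v *)
From mathcomp Require Import all_boot all_order.
From mathcomp Require Import boolp classical_sets.

Set Implicit Arguments.
Unset Strict Implicit.
Unset Printing Implicit Defensive.

Local Open Scope classical_set_scope.

Definition baire := nat -> nat.

(* Partial maps  A -> B  are functions  A -> option B, composed with obind. *)
Definition partial_of_rel (A B : Type) (R : A -> B -> Prop) (a : A) : option B :=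
  if pselect (exists b, R a b) is left h then Some (projT1 (cid h)) else None.

(* Mu-recursive programs with an oracle. A program takes a finite list of
   arguments; missing arguments are read as 0. *)
Inductive program : Type :=
  | Zero
  | Succ
  | Proj of nat
  | Oracle
  | Comp of program & seq program
  | PrimRec of program & program
  | Mu of program.

(* [computes p e v y]: with oracle p, the program e halts on v with output y.
   In the PrimRec clause s is the sequence of intermediate values. *)
Fixpoint computes (p : baire) (e : program) (v : seq nat) (y : nat) : Prop :=
  match e with
  | Zero => y = 0
  | Succ => y = (head 0 v).+1
  | Proj i => y = nth 0 v i
  | Oracle => y = p (head 0 v)
  | Comp f gs =>
      exists2 w : seq nat,
        (fix computes_all (gs : seq program) (w : seq nat) : Prop :=
           match gs, w with
           | [::], [::] => True
           | g :: gs', z :: w' => computes p g v z /\ computes_all gs' w'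
           | _, _ => False
           end) gs w
        & computes p f w y
  | PrimRec f g =>
      exists s : nat -> nat,
        [/\ computes p f (behead v) (s 0),
            forall i, i < head 0 v ->
              computes p g [:: i, s i & behead v] (s i.+1)
          & y = s (head 0 v)]
  | Mu f =>
      computes p f (y :: v) 0 /\
      forall i, i < y -> exists k, computes p f (i :: v) k.+1
  end.

(* The program may also halt outside dom(F): restrictions of computable maps
   are computable. *)
Definition computable (F : baire -> option baire) : Prop :=
  exists e : program, forall p q, F p = Some q ->
    forall n, computes p e [:: n] (q n).

Definition total (A B : Type) (F : A -> option B) : Prop := forall a, F a <> None.

Record representation (X : Type) : Type := Representation {
  rep :> baire -> option X;
  rep_surj : forall x, exists p, rep p = Some x
}.

Record repspace : Type := RepSpace {
  carrier :> Type;
  delta : representation carrier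
}.

Definition rep_reducible (X : Type) (d d' : representation X) : Prop :=
  exists2 F : baire -> option baire, computable F &
    forall p, d p <> None -> obind d' (F p) = d p.

Definition rep_equiv (X : Type) (d d' : representation X) : Prop :=
  rep_reducible d d' /\ rep_reducible d' d.

Definition precomplete (X : Type) (d : representation X) : Prop :=
  forall F : baire -> option baire, computable F ->
    exists G : baire -> option baire, [/\ computable G, total G &
      forall p, F p <> None -> obind d (F p) = obind d (G p)].

(* The domain of a problem is the set of inputs with a nonempty value. *)
Record problem : Type := Problem {
  source : repspace;
  target : repspace;
  values :> source -> set target
}.

Definition dom (f : problem) : set (source f) := [set x | f x !=set0].
Arguments dom : clear implicits.

Definition realizes (f : problem)
    (dX : representation (source f)) (dY : representation (target f))
    (F : baire -> option baire) : Prop :=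
  forall p x, dX p = Some x -> dom f x ->
    exists2 y, obind dY (F p) = Some y & f x y.

Definition total_realizer (f : problem)
    (dX : representation (source f)) (dY : representation (target f))
    (F : baire -> option baire) : Prop :=
  total F /\ realizes dX dY F.

Definition precomplete_variant (X : repspace) (d : representation X) : Prop :=
  precomplete d /\ rep_equiv d (delta X).

Definition stW_le (f g : problem) : Prop :=
  exists (dX : representation (source f)) (dY : representation (target f))
         (dU : representation (source g)) (dV : representation (target g)),
    [/\ precomplete_variant dX, precomplete_variant dY,
        precomplete_variant dU, precomplete_variant dV
      & exists H K : baire -> option baire,
          [/\ computable H, computable K
            & forall G, total_realizer dU dV G ->
                total_realizer dX dY (fun p => obind H (obind G (K p)))]].

Definition stW_equiv (f g : problem) : Prop := stW_le f g /\ stW_le g f.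

Record degree : Type := Degree {
  members : set problem;
  membersP : exists f, members = [set g | stW_equiv f g]
}.

Definition deg (f : problem) : degree :=
  @Degree [set g | stW_equiv f g] (ex_intro _ f erefl).

(* The concatenation of p(0)-1, ..., p(n-1)-1, where 0-1 is the empty word. *)
Definition minus1_word (p : baire) (n : nat) : seq nat :=
  [seq k.-1 | k <- mkseq p n & k != 0].

Definition is_minus1 (p q : baire) : Prop :=
  forall m, exists n, prefix (mkseq q m) (minus1_word p n).

(* p-1, which is undefined when the concatenation is only a finite word. *)
Definition minus1 : baire -> option baire := partial_of_rel is_minus1.

Definition precompletion (X : Type) (d : baire -> option X) : baire -> option X :=
  fun p => obind d (minus1 p).

(* The completion of X is  option X, where None is the bottom element. *)
Definition completion_rep (X : repspace) : baire -> option (option X) :=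
  fun p => Some (precompletion (delta X) p).

Lemma minus1_wordD p n m :
  minus1_word p (n + m) =
  minus1_word p n ++ [seq k.-1 | k <- [seq p i | i <- iota n m] & k != 0].
Proof. by rewrite /minus1_word /mkseq iotaD map_cat filter_cat map_cat. Qed.

Lemma is_minus1_uniq p q q' : is_minus1 p q -> is_minus1 p q' -> q = q'.
Proof.
move=> hq hq'; apply/funext => i.
have [n hn] := hq i.+1; have [n' hn'] := hq' i.+1.
have nthW r k : prefix (mkseq r i.+1) (minus1_word p k) ->
    forall l, k <= l -> nth 0 (minus1_word p l) i = r i.
  move=> /prefixP [s hs] l /subnKC <-.
  have lti : i < size (mkseq r i.+1) by rewrite size_mkseq.
  by rewrite minus1_wordD hs -catA nth_cat lti nth_mkseq.
by rewrite -(nthW _ _ hn (maxn n n')) ?leq_maxl //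
           -(nthW _ _ hn' (maxn n n')) ?leq_maxr.
Qed.

Lemma minus1_eq p q : is_minus1 p q -> minus1 p = Some q.
Proof.
move=> h; rewrite /minus1 /partial_of_rel; case: pselect => [h'|[]]; last by exists q.
by congr Some; apply: is_minus1_uniq h; case: (cid h').
Qed.

Lemma minus1_S q : minus1 (S \o q) = Some q.
Proof.
apply: minus1_eq => m; exists m.
suff -> : minus1_word (S \o q) m = mkseq q m by exact: prefix_refl.
rewrite /minus1_word /mkseq (@map_comp _ _ _ S q) filter_map -map_comp.
by rewrite (@eq_filter _ _ predT) // filter_predT -map_comp; apply: eq_map.
Qed.

Lemma minus1_0 : minus1 (fun=> 0) = None.
Proof.
rewrite /minus1 /partial_of_rel; case: pselect => // h.
exfalso; case: h => q /(_ 1)[n].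
suff -> : minus1_word (fun=> 0) n = [::] by [].
rewrite /minus1_word /mkseq; move: (iota 0 n) => s.
by elim: s.
Qed.

Lemma completion_rep_surj (X : repspace) x :
  exists p, completion_rep X p = Some x.
Proof.
rewrite /completion_rep /precompletion; case: x => [x|].
  by have [p hp] := rep_surj (delta X) x; exists (S \o p); rewrite minus1_S /= hp.
by exists (fun=> 0); rewrite minus1_0.
Qed.

Definition completion (X : repspace) : repspace :=
  RepSpace (Representation (@completion_rep_surj X)).

(* Names of pairs: <p,q>(2n) = p(n), <p,q>(2n+1) = q(n). *)
Definition prod_rep (X Y : repspace) : baire -> option (X * Y) :=
  fun p =>
    obind (fun x => omap (pair x) (delta Y (fun n => p n.*2.+1)))
          (delta X (fun n => p n.*2)).

Lemma prod_rep_surj (X Y : repspace) z : exists p, prod_rep X Y p = Some z.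
Proof.
case: z => x y.
have [p hp] := rep_surj (delta X) x; have [q hq] := rep_surj (delta Y) y.
exists (fun n => if odd n then q n./2 else p n./2); rewrite /prod_rep.
have -> : (fun n => if odd n.*2 then q n.*2./2 else p n.*2./2) = p.
  by apply/funext => n; rewrite odd_double doubleK.
have -> : (fun n => if odd n.*2.+1 then q n.*2.+1./2 else p n.*2.+1./2) = q.
  by apply/funext => n; rewrite /= odd_double /= uphalf_double.
by rewrite hp /= hq.
Qed.

Definition prod_space (X Y : repspace) : repspace :=
  RepSpace (Representation (@prod_rep_surj X Y)).

(* Names of points of a sum: 0p names (0,x) and 1q names (1,y). *)
Definition sum_rep (X Y : repspace) : baire -> option (X + Y) :=
  fun p =>
    match p 0 with
    | 0 => omap inl (delta X (fun n => p n.+1))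
    | 1 => omap inr (delta Y (fun n => p n.+1))
    | _ => None
    end.

Lemma sum_rep_surj (X Y : repspace) z : exists p, sum_rep X Y p = Some z.
Proof.
case: z => [x|y].
  have [p hp] := rep_surj (delta X) x.
  by exists (fun n => if n is n'.+1 then p n' else 0); rewrite /sum_rep /= hp.
have [p hp] := rep_surj (delta Y) y.
by exists (fun n => if n is n'.+1 then p n' else 1); rewrite /sum_rep /= hp.
Qed.

Definition sum_space (X Y : repspace) : repspace :=
  RepSpace (Representation (@sum_rep_surj X Y)).

Definition completion_problem (f : problem) : problem :=
  @Problem (completion (source f)) (completion (target f))
    (fun x => if x is Some x' then
                [set y | dom f x' -> exists2 y', y = Some y' & f x' y']
              else setT).

Definition sqcap (f g : problem) : problem :=
  @Problem (prod_space (source f) (source g)) (sum_space (target f) (target g))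
    (fun xu => [set z | [/\ dom f xu.1, dom g xu.2
                          & match z with inl y => f xu.1 y | inr v => g xu.2 v end]]).

Definition boxplus (f g : problem) : problem :=
  @Problem (sum_space (source f) (source g))
    (prod_space (completion (target f)) (completion (target g)))
    (fun z => match z with
              | inl x => [set yv | exists2 y, yv.1 = Some y & f x y]
              | inr u => [set yv | exists2 v, yv.2 = Some v & g u v]
              end).

(* Main.v *)
Require Import Defs.
From Stdlib Require List.
From HB Require Import structures.
From mathcomp Require Import all_boot all_order.
From mathcomp Require Import boolp classical_sets.

(** For precomplete representations, [f] is reducible to [g] iff there are total
    computable [H] and [K] such that [H q] solves [p] for [f] whenever [q] solves
    [K p] for [g]; here everything solves a [p] that names no point of the domain.
    This makes the infimum "an instance of each problem, a solution of one of
    them" and the supremum "an instance of one of the problems, a candidate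
    solution for each". The case distinctions that remain are partial computable
    maps, made total by precompleteness, which rests on step-indexed evaluation
    of programs.

    Distributivity fails for [f : 0 |-> alpha], [g : beta |-> beta] and
    [h : 0 |-> gamma], problems with one instance and one solution, each with a
    single name, where [alpha] is not computable, [gamma] is not computable in
    [alpha], and [beta] is not computable in [(alpha, gamma)]. A reduction of
    the infimum of [f \/ g] and [h] to the supremum of [f /\ h] and [g /\ h]
    must send [f]-instances to the left and [g]-instances to the right. Given
    [alpha] on the left and [gamma] on the right it cannot know which side is
    reliable, and as it cannot produce [beta] it has to commit itself to [gamma];
    by continuity it still does so when the right side is cut off after finitely
    many digits, and then it computes [gamma] from [alpha]. *)

Set Implicit Arguments.
Unset Strict Implicit.
Unset Printing Implicit Defensive.

(** * Oracle computability *)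

(** The induction has to reach the programs in the list under [Comp], hence the inner fixpoint. *)
Definition program_nested_ind (P : program -> Prop)
    (P_Zero : P Zero) (P_Succ : P Succ) (P_Proj : forall i, P (Proj i))
    (P_Oracle : P Oracle)
    (P_Comp : forall f gs, P f -> List.Forall P gs -> P (Comp f gs))
    (P_PrimRec : forall f g, P f -> P g -> P (PrimRec f g))
    (P_Mu : forall f, P f -> P (Mu f)) : forall e, P e :=
  fix ind (e : program) : P e :=
  match e with
  | Zero => P_Zero
  | Succ => P_Succ
  | Proj i => P_Proj i
  | Oracle => P_Oracle
  | Comp f gs => P_Comp _ _ (ind f)
      ((fix all_P (gs : seq program) : List.Forall P gs :=
          match gs with
          | [::] => List.Forall_nil P
          | g :: gs' => List.Forall_cons g (ind g) (all_P gs')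
          end) gs)
  | PrimRec f g => P_PrimRec _ _ (ind f) (ind g)
  | Mu f => P_Mu _ (ind f)
  end.

Lemma computes_Comp p f gs v y :
  computes p (Comp f gs) v y <->
  exists2 w, List.Forall2 (fun g z => computes p g v z) gs w & computes p f w y.
Proof.
split=> -[w hw hf]; exists w => //.
  elim: gs w hw {hf} => [|g gs IH] [|z w] //=.
  by case=> hg /IH; constructor.
by elim: hw.
Qed.

(** An oracle call reads the head of any list, while [g] is only assumed correct on one-element
    lists; [Comp g [:: Proj 0]] cuts the list down. *)
Fixpoint oracle_subst (g e : program) : program :=
  match e with
  | Oracle => Comp g [:: Proj 0]
  | Comp f gs => Comp (oracle_subst g f) [seq oracle_subst g e' | e' <- gs]
  | PrimRec f h => PrimRec (oracle_subst g f) (oracle_subst g h)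
  | Mu f => Mu (oracle_subst g f)
  | _ => e
  end.

Lemma oracle_substP p q g e v y :
  (forall n, computes p g [:: n] (q n)) ->
  computes q e v y -> computes p (oracle_subst g e) v y.
Proof.
move=> hg; elim/program_nested_ind: e v y => //.
- by move=> v y /= ->; exists [:: nth 0 v 0] => //; rewrite nth0.
- move=> f gs IHf IHgs v y /computes_Comp [w hw /IHf hf].
  apply/computes_Comp; exists w => //; elim: hw IHgs {hf} => /= [|e z es w' he _ IH].
    by constructor.
  by move=> /List.Forall_cons_iff [/(_ _ _ he) ? /IH]; constructor.
- move=> f h IHf IHh v y /= [s [h0 hs ->]]; exists s; split=> //; first exact: IHf.
  by move=> i /hs /IHh.
- move=> f IHf v y /= [/IHf h0 hi]; split=> // i /hi [k /IHf]; by exists k.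
Qed.

(** Serves to merge the bounds for the rounds of a [PrimRec] and for the failed trials of a [Mu]. *)
Lemma exists_uniform_bound (Q : nat -> nat -> Prop) n :
  (forall i m m', m <= m' -> Q i m -> Q i m') ->
  (forall i, i < n -> exists m, Q i m) ->
  exists m, forall i, i < n -> Q i m.
Proof.
move=> mono; elim: n => [|n IH] ex; first by exists 0.
have [i lt_in|m hm] := IH; first by apply: ex; exact: ltnW.
have [m' hm'] := ex n (ltnSn n); exists (maxn m m') => i.
rewrite ltnS leq_eqVlt => /orP [/eqP ->|/hm].
  by apply: mono hm'; rewrite leq_maxr.
by apply: mono; rewrite leq_maxl.
Qed.

(** * Continuity: a computation uses finitely much of its oracle *)

Definition agree (m : nat) (p p' : baire) := forall i, i < m -> p' i = p i.

Lemma agreeW m m' p p' : m <= m' -> agree m' p p' -> agree m p p'.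
Proof. by move=> le_m h i lt_i; apply: h; exact: leq_trans le_m. Qed.

(** A halting computation consists of finitely many smaller ones; the largest of their bounds works
    for it. *)
Lemma computes_continuous p e v y :
  computes p e v y -> exists m, forall p', agree m p p' -> computes p' e v y.
Proof.
elim/program_nested_ind: e v y; try by exists 0.
- move=> v y /= ->; exists (head 0 v).+1 => p' hp'.
  by rewrite hp'.
- move=> f gs IHf IHgs v y /computes_Comp [w hw /IHf [m hm]].
  suff [m' hm'] : exists m', forall p', agree m' p p' ->
      List.Forall2 (fun g z => computes p' g v z) gs w.
    exists (maxn m m') => p' hp'; apply/computes_Comp; exists w.
      by apply: hm'; apply: agreeW hp'; rewrite leq_maxr.
    by apply: hm; apply: agreeW hp'; rewrite leq_maxl.
  elim: hw IHgs {hm} => [|g z gs' w' hg _ IH].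
    by exists 0 => p' _; constructor.
  move=> /List.Forall_cons_iff [/(_ _ _ hg) [m1 h1] /IH [m2 h2]].
  exists (maxn m1 m2) => p' hp'; constructor.
    by apply: h1; apply: agreeW hp'; rewrite leq_maxl.
  by apply: h2; apply: agreeW hp'; rewrite leq_maxr.
- move=> f g IHf IHg v y /= [s [/IHf [m0 h0] hs ->]].
  have [] := @exists_uniform_bound (fun i m => forall p', agree m p p' ->
      computes p' g [:: i, s i & behead v] (s i.+1)) (head 0 v).
  + by move=> i m m' le_m h p' /(agreeW le_m) /h.
  + by move=> i /hs /IHg.
  move=> m hm; exists (maxn m0 m) => p' hp'; exists s; split=> //.
    by apply: h0; apply: agreeW hp'; rewrite leq_maxl.
  by move=> i /hm; apply; apply: agreeW hp'; rewrite leq_maxr.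
- move=> f IHf v y /= [/IHf [m0 h0] hs].
  have /choice [s {}hs] : forall i, exists k, i < y -> computes p f (i :: v) k.+1.
    move=> i; case: (ltnP i y) => [/hs [k]|]; last by exists 0.
    by exists k.
  have [] := @exists_uniform_bound (fun i m => forall p', agree m p p' ->
      computes p' f (i :: v) (s i).+1) y.
  + by move=> i m m' le_m h p' /(agreeW le_m) /h.
  + by move=> i /hs /IHf.
  move=> m hm; exists (maxn m0 m) => p' hp'; split.
    by apply: h0; apply: agreeW hp'; rewrite leq_maxl.
  move=> i /hm h; exists (s i); apply: h.
  by apply: agreeW hp'; rewrite leq_maxr.
Qed.

(** * Closure properties of functions computed by programs that halt for every oracle *)

Definition cpt (k : nat) (F : baire -> seq nat -> nat) :=
  exists e, forall p v, size v = k -> computes p e v (F p v).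

Lemma cpt_ext k F G :
  (forall p v, size v = k -> F p v = G p v) -> cpt k F -> cpt k G.
Proof. by move=> FG [e he]; exists e => p v sv; rewrite -FG //; exact: he. Qed.

Lemma cpt_nth k i : cpt k (fun _ v => nth 0 v i).
Proof. by exists (Proj i). Qed.

Lemma cpt_comp m k F (Gs : seq (baire -> seq nat -> nat)) :
  cpt m F -> size Gs = m -> List.Forall (cpt k) Gs ->
  cpt k (fun p v => F p [seq G p v | G <- Gs]).
Proof.
move=> [e he] sG hG.
have [es hes] : exists es, forall p v, size v = k ->
    List.Forall2 (fun g z => computes p g v z) es [seq G p v | G <- Gs].
  elim: hG {sG} => [|G Gs' [g hg] _ [es hes]]; first by exists [::] => *; constructor.
  by exists (g :: es) => p v sv /=; constructor; [exact: hg | exact: hes].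
exists (Comp e es) => p v sv; apply/computes_Comp.
exists [seq G p v | G <- Gs]; first exact: hes.
by apply: he; rewrite size_map.
Qed.

Lemma Forall_cpt_nth m s :
  List.Forall (cpt m) [seq (fun (_ : baire) (v : seq nat) => nth 0 v i) | i <- s].
Proof. by elim: s => [|i s IH] /=; constructor=> //; exact: cpt_nth. Qed.

Lemma drop_map_nth m k (v : seq nat) : size v = m + k ->
  drop m v = [seq nth 0 v i | i <- iota m k].
Proof.
by move=> sv; rewrite map_nth_iota ?sv ?addKn // take_oversize // size_drop sv addKn.
Qed.

Lemma cpt_reindex k s F : cpt (size s) F -> cpt k (fun p v => F p [seq nth 0 v i | i <- s]).
Proof.
move=> hF; pose Gs := [seq (fun (_ : baire) (v : seq nat) => nth 0 v i) | i <- s].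
apply: cpt_ext (@cpt_comp (size s) k F Gs hF _ _).
- by move=> p v _; rewrite -map_comp.
- by rewrite size_map.
- exact: Forall_cpt_nth.
Qed.

Lemma cpt_drop m k F : cpt k F -> cpt (m + k) (fun p v => F p (drop m v)).
Proof.
move=> hF; have hF' : cpt (size (iota m k)) F by rewrite size_iota.
apply: cpt_ext (cpt_reindex (m + k) hF') => p v sv; congr (F p _).
by rewrite -drop_map_nth.
Qed.

Lemma cpt_succ k A : cpt k A -> cpt k (fun p v => (A p v).+1).
Proof.
move=> hA; apply: (@cpt_comp 1 k (fun _ v => (head 0 v).+1) [:: A]) => //.
  by exists Succ.
by do !constructor.
Qed.

Lemma cpt_const k c : cpt k (fun _ _ => c).
Proof. by elim: c => [|c IH]; [exists Zero | exact: cpt_succ]. Qed.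

Lemma cpt_oracle k A : cpt k A -> cpt k (fun p v => p (A p v)).
Proof.
move=> hA; apply: (@cpt_comp 1 k (fun p v => p (head 0 v)) [:: A]) => //.
  by exists Oracle.
by do !constructor.
Qed.

(** [PrimRec] takes the number of rounds as its first argument; composing with [N] there and with
    projections elsewhere lets that number be computed from the other arguments. *)
Lemma cpt_iteri k (N B : baire -> seq nat -> nat)
    (S : baire -> nat -> nat -> seq nat -> nat) :
  cpt k N -> cpt k B ->
  cpt k.+2 (fun p v => S p (nth 0 v 0) (nth 0 v 1) (drop 2 v)) ->
  cpt k (fun p v => iteri (N p v) (fun i s => S p i s v) (B p v)).
Proof.
move=> hN [eB heB] [eS heS].
pose R p v := iteri (head 0 v) (fun i s => S p i s (behead v)) (B p (behead v)).
have hR : cpt k.+1 R.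
  exists (PrimRec eB eS) => p v sv /=.
  exists (fun n => iteri n (fun i s => S p i s (behead v)) (B p (behead v))).
  have sb : size (behead v) = k by rewrite size_behead sv.
  split=> //; first exact: heB.
  move=> i _; have /= := heS p [:: i, iteri i (fun i s => S p i s (behead v)) (B p (behead v)) & behead v].
  by rewrite drop0 sb; apply.
pose projs := [seq (fun (_ : baire) (v : seq nat) => nth 0 v i) | i <- iota 0 k].
apply: cpt_ext (@cpt_comp _ k R (N :: projs) hR _ _).
- move=> p v sv; rewrite /R /= -map_comp.
  suff -> : [seq ((fun G => G p v) \o
     (fun i (_ : baire) (v : seq nat) => nth 0 v i)) i | i <- iota 0 k] = v by [].
  by rewrite -{2}[v](@mkseq_nth _ 0) /mkseq sv.
- by rewrite /= size_map size_iota.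
- by constructor=> //; exact: Forall_cpt_nth.
Qed.

Lemma cpt_weaken2 k A : cpt k A -> cpt k.+2 (fun p v => A p (drop 2 v)).
Proof. exact: (@cpt_drop 2). Qed.

(** The iteration forgets its accumulator and returns the last counter, which is the predecessor of
    the number of rounds. *)
Lemma cpt_pred k A : cpt k A -> cpt k (fun p v => (A p v).-1).
Proof.
move=> hA; apply: cpt_ext (cpt_iteri (S := fun _ i _ _ => i) hA (cpt_const k 0) (cpt_nth _ 0)).
by move=> p v _; case: (A p v).
Qed.

Lemma cpt_add k A B : cpt k A -> cpt k B -> cpt k (fun p v => A p v + B p v).
Proof.
move=> hA hB; have hS := cpt_succ (cpt_nth k.+2 1).
apply: cpt_ext (cpt_iteri (S := fun _ _ s _ => s.+1) hB hA hS) => p v _.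
by elim: (B p v) => [|n IH]; rewrite ?addn0 // iteriS IH addnS.
Qed.

Lemma cpt_subn k A B : cpt k A -> cpt k B -> cpt k (fun p v => A p v - B p v).
Proof.
move=> hA hB; have hS := cpt_pred (cpt_nth k.+2 1).
apply: cpt_ext (cpt_iteri (S := fun _ _ s _ => s.-1) hB hA hS) => p v _.
by elim: (B p v) => [|n IH]; rewrite ?subn0 // iteriS IH subnS.
Qed.

(** The condition, read as a number, is the number of rounds: no round leaves [B], one round
    overwrites it by [A]. *)
Lemma cpt_if k (C : baire -> seq nat -> bool) A B :
  cpt k (fun p v => C p v : nat) -> cpt k A -> cpt k B ->
  cpt k (fun p v => if C p v then A p v else B p v).
Proof.
move=> hC hA hB.
apply: cpt_ext (cpt_iteri (S := fun p _ _ v => A p v) hC hB (cpt_weaken2 hA)) => p v _.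
by case: (C p v).
Qed.

Lemma cpt_eq0 k A : cpt k A -> cpt k (fun p v => (A p v == 0) : nat).
Proof.
move=> hA; apply: cpt_ext (cpt_subn (cpt_const k 1) hA) => p v _.
by case: (A p v).
Qed.

Lemma cpt_neq0 k A : cpt k A -> cpt k (fun p v => (A p v != 0) : nat).
Proof.
move=> hA; apply: cpt_ext (cpt_subn (cpt_const k 1) (cpt_eq0 hA)) => p v _.
by case: (A p v).
Qed.

Lemma cpt_odd k A : cpt k A -> cpt k (fun p v => odd (A p v) : nat).
Proof.
move=> hA; have hS := cpt_eq0 (cpt_nth k.+2 1).
apply: cpt_ext (cpt_iteri (S := fun _ _ s _ => (s == 0) : nat) hA (cpt_const k 0) hS).
by move=> p v _; elim: (A p v) => [|n IH] //; rewrite iteriS IH /=; case: odd.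
Qed.

Lemma cpt_half k A : cpt k A -> cpt k (fun p v => (A p v)./2).
Proof.
move=> hA; have hS := cpt_add (cpt_odd (cpt_nth k.+2 0)) (cpt_nth k.+2 1).
apply: cpt_ext (cpt_iteri (S := fun _ i s _ => odd i + s) hA (cpt_const k 0) hS).
by move=> p v _; elim: (A p v) => [|n IH] //; rewrite iteriS IH /= uphalf_half.
Qed.

(** Hard-wires a finite table into a program; the final argument uses it for a sequence cut off
    after finitely many digits. *)
Lemma cpt_lookup k s A : cpt k A -> cpt k (fun p v => nth 0 s (A p v)).
Proof.
elim: s A => [|c s IH] A hA.
  by apply: cpt_ext (cpt_const k 0) => p v _; rewrite nth_nil.
apply: cpt_ext (cpt_if (cpt_eq0 hA) (cpt_const k c) (IH _ (cpt_pred hA))) => p v _.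
by case: (A p v).
Qed.

(* [E p t v] runs [e] for [t] steps: it is [0] while [e] has not halted, and
   [y.+1] once it has halted with output [y]. *)
Definition step_indexed (k : nat) (e : program) (E : baire -> nat -> seq nat -> nat) :=
  [/\ cpt k.+1 (fun p v => E p (head 0 v) (behead v)),
      forall p t t' v y, t <= t' -> E p t v = y.+1 -> E p t' v = y.+1
    & forall p v y, size v = k -> computes p e v y -> exists t, E p t v = y.+1].

Lemma cpt_step_indexed k e E m (T : baire -> seq nat -> nat) Gs :
  step_indexed k e E -> cpt m T -> size Gs = k -> List.Forall (cpt m) Gs ->
  cpt m (fun p v => E p (T p v) [seq G p v | G <- Gs]).
Proof.
move=> [hE _ _] hT sG hG.
apply: (@cpt_comp _ m (fun p v => E p (head 0 v) (behead v)) (T :: Gs) hE).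
  by rewrite /= sG.
by constructor.
Qed.

(* Search over [i < n] for [c i = 1], where [c i = 0] blocks it.
   The value is [0] while searching, [1] when blocked, [y.+2] when [y] is found. *)
Definition search (c : nat -> nat) (n : nat) : nat :=
  iteri n (fun y st => if st == 0 then
                         if c y == 0 then 1 else if (c y).-1 == 0 then y.+2 else 0
                       else st) 0.

Lemma search_eq0 c n : search c n = 0 <-> forall i, i < n -> 1 < c i.
Proof.
elim: n => [|n IH] //; rewrite /search iteriS -/(search c n); split.
  case: eqP => [/IH h|//]; case cn: (c n) => [|[|k]] // _ i.
  by rewrite ltnS leq_eqVlt => /orP [/eqP ->|/h //]; rewrite cn.
move=> h; have -> /= : search c n = 0 by apply/IH => i lt_in; apply: h; exact: ltnW.
by case: (c n) (h n (ltnSn n)) => [|[|k]].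
Qed.

Lemma search_found c n y :
  search c n = y.+2 <-> [/\ y < n, c y = 1 & forall i, i < y -> 1 < c i].
Proof.
elim: n => [|n IH]; first by split=> [|[]].
rewrite /search iteriS -/(search c n); split.
  case: eqP => [/search_eq0 h|_ /IH [lt_yn ? ?]]; last by split=> //; exact: ltnW.
  by case cn: (c n) => [|[|k]] //= [<-].
case; rewrite ltnS leq_eqVlt => /orP [/eqP -> cn /search_eq0 ->|lt_yn cy h].
  by rewrite cn.
by have -> : search c n = y.+2 by apply/IH.
Qed.

(** All parts share the step bound. The outer program starts only when every inner one has halted,
    and predecessors turn their values into outputs. *)
Lemma step_indexed_Comp k f gs Ef (Es : seq (baire -> nat -> seq nat -> nat)) :
  step_indexed (size gs) f Ef -> List.Forall2 (step_indexed k) gs Es ->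
  step_indexed k (Comp f gs) (fun p t v =>
    if all (fun G => G p t v != 0) Es
    then Ef p t [seq (G p t v).-1 | G : baire -> nat -> seq nat -> nat <- Es] else 0).
Proof.
move=> hf hgs.
have sEs : size Es = size gs by elim: hgs => //= *; congr S.
split.
- apply: cpt_if; last exact: cpt_const.
    elim: hgs => [|g G gs' Es' [hG _ _] _ IH] /=; first exact: cpt_const.
    apply: cpt_ext (cpt_if (cpt_neq0 hG) IH (cpt_const _ 0)) => p v _.
    by case: eqP.
  pose Gs := [seq (fun (p : baire) (v : seq nat) => (G p (head 0 v) (behead v)).-1)
             | G : baire -> nat -> seq nat -> nat <- Es].
  apply: cpt_ext (@cpt_step_indexed _ _ _ k.+1 (fun _ v => nth 0 v 0) Gs hf _ _ _).
  + by move=> p v _; rewrite -map_comp nth0.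
  + exact: cpt_nth.
  + by rewrite size_map.
  + rewrite /Gs; elim: hgs => [|g G gs' Es' [hG _ _] _ IH] /=; constructor=> //.
    exact: cpt_pred.
- move=> p t t' v y le_t; case: ifP => // hall.
  have [-> ->] : all (fun G => G p t' v != 0) Es /\
     [seq (G p t' v).-1 | G : baire -> nat -> seq nat -> nat <- Es] =
     [seq (G p t v).-1 | G : baire -> nat -> seq nat -> nat <- Es].
    elim: hgs hall => [|g G gs' Es' [_ mG _] _ IH] //= /andP [+ /IH [-> ->]].
    case E : (G p t v) => [//|z] _.
    by rewrite (mG _ _ _ _ _ le_t E).
  by have [_ mf _] := hf; exact: mf.
- move=> p v y sv /computes_Comp [w hw hy].
  have [t [hall hmap]] : exists t, all (fun G => G p t v != 0) Es /\
     [seq (G p t v).-1 | G : baire -> nat -> seq nat -> nat <- Es] = w.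
    elim: hgs w hw {hy sEs} => [|g G gs' Es' hG hgs' IH] w hw.
      by inversion hw; exists 0.
    case: w hw => [|z w'] hw; first by inversion hw.
    case/List.Forall2_cons_iff: (hw) => hz hw'.
    have [t1 [h1 h2]] := IH _ hw'; have [_ mG /(_ p v z sv hz) [t2 ht2]] := hG.
    (* The head has halted by step [t2], the tail by step [t1]; monotonicity carries both to the
       maximum. *)
    exists (maxn t1 t2).
    rewrite /= (mG _ _ _ _ _ (leq_maxr t1 t2) ht2) /=.
    elim: hgs' w' h1 h2 {IH hw' hw} => [|g' G' gs'' Es'' [_ mG' _] _ IH] w' //=.
      by move=> _ <-.
    case E : (G' p t1 v) => [//|z'] /= h1 <-.
    rewrite (mG' _ _ _ _ _ (leq_maxl t1 t2) E) /=.
    by have [-> [->]] := IH _ h1 erefl.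
  have [_ mf cf] := hf.
  have sw : size w = size gs by rewrite -hmap size_map.
  have [t' ht'] := cf _ _ _ sw hy; exists (maxn t t').
  have [-> ->] : all (fun G => G p (maxn t t') v != 0) Es /\
     [seq (G p (maxn t t') v).-1 | G : baire -> nat -> seq nat -> nat <- Es] = w.
    rewrite -hmap; elim: hgs hall {hmap sEs} => [|g G gs' Es' [_ mG _] _ IH] //=.
    move=> /andP [+ /IH [-> ->]]; case E : (G p t v) => [//|z] _.
    by rewrite (mG _ _ _ _ _ (leq_maxl t t') E).
  by apply: mf ht'; rewrite leq_maxr.
Qed.

(** The accumulator keeps the shifted form, so that 0 is absorbing once a round has not halted. If
    [k] is 0, the missing recursion argument reads as 0, and [k.-1] is still the length of
    [behead v]. *)
Lemma step_indexed_PrimRec k f g Ef Eg :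
  step_indexed k.-1 f Ef -> step_indexed k.-1.+2 g Eg ->
  step_indexed k (PrimRec f g) (fun p t v =>
    iteri (head 0 v) (fun i s => if s == 0 then 0 else Eg p t [:: i, s.-1 & behead v])
      (Ef p t (behead v))).
Proof.
move=> hf hg; have [_ mf cf] := hf; have [_ mg cg] := hg.
have mono p t t' v n y : t <= t' ->
    iteri n (fun i s => if s == 0 then 0 else Eg p t [:: i, s.-1 & v]) (Ef p t v) = y.+1 ->
    iteri n (fun i s => if s == 0 then 0 else Eg p t' [:: i, s.-1 & v]) (Ef p t' v) = y.+1.
  move=> le_t; elim: n y => [|n IH] y /=; first exact: mf.
  case E: (iteri n _ _) => [//|z] /=; rewrite (IH _ E) /=; exact: mg.
split.
- apply: cpt_iteri.
  + by apply: cpt_ext (cpt_nth _ 1) => p [|t [|n v]].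
  + pose Gs := [seq (fun (_ : baire) (v : seq nat) => nth 0 v i) | i <- iota 2 k.-1].
    apply: cpt_ext (@cpt_step_indexed _ _ _ k.+1 (fun _ v => nth 0 v 0) Gs hf _ _ _).
    * move=> p v sv; rewrite nth0 -map_comp; congr (Ef p _ _).
      case: k sv {hf hg cf cg Gs} => [|k] sv; first by case: v sv => [|? [|]].
      by rewrite -[RHS]drop1 -[behead v]drop1 drop_drop (@drop_map_nth 2 k).
    * exact: cpt_nth.
    * by rewrite size_map size_iota.
    * exact: Forall_cpt_nth.
  + apply: cpt_if; [exact: cpt_eq0 (cpt_nth _ 1)|exact: cpt_const|].
    pose Gs := [:: (fun (_ : baire) (v : seq nat) => nth 0 v 0),
                   (fun (_ : baire) (v : seq nat) => (nth 0 v 1).-1) &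
      [seq (fun (_ : baire) (v : seq nat) => nth 0 v i) | i <- iota 4 k.-1]].
    apply: cpt_ext (@cpt_step_indexed _ _ _ k.+3 (fun _ v => nth 0 v 2) Gs hg _ _ _).
    * move=> p v sv; rewrite /= -map_comp -nth0 nth_drop; congr (Eg p _ [:: _, _ & _]).
      case: k sv {hf hg cf cg Gs} => [|k] sv; first by case: v sv => [|? [|? [|? []]]].
      by rewrite -!drop1 !drop_drop (@drop_map_nth 4 k).
    * exact: cpt_nth.
    * by rewrite /= size_map size_iota.
    * constructor; first exact: cpt_nth.
      constructor; first exact: cpt_pred (cpt_nth _ 1).
      exact: Forall_cpt_nth.
- by move=> p t t' v y le_t; exact: mono.
- move=> p v y sv /= [s [h0 hs ->]].
  have sb : size (behead v) = k.-1 by rewrite size_behead sv.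
  elim: (head 0 v) hs => [|n IH] hs; first exact: cf.
  have [i lt_in|t1 h1] := IH; first by apply: hs; exact: ltnW.
  have [|t2 h2] := cg _ _ _ _ (hs n (ltnSn n)); first by rewrite /= sb.
  exists (maxn t1 t2); rewrite iteriS (mono _ _ _ _ _ _ (leq_maxl t1 t2) h1) /=.
  by apply: mg h2; rewrite leq_maxr.
Qed.

(** A shifted value 0 of [Ef] is a trial still running, 1 a zero of [f], and more than 1 a failed
    trial. The predecessor merges the two unsuccessful states of [search] into 0. *)
Lemma step_indexed_Mu k f Ef :
  step_indexed k.+1 f Ef ->
  step_indexed k (Mu f) (fun p t v => (search (fun y => Ef p t (y :: v)) t).-1).
Proof.
move=> hf; have [_ mf cf] := hf; split.
- apply: cpt_pred; apply: cpt_iteri.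
  + by apply: cpt_ext (cpt_nth _ 0) => p [|t [|n v]].
  + exact: cpt_const.
  + have hE : cpt k.+3 (fun p v =>
        Ef p (head 0 (drop 2 v)) (nth 0 v 0 :: behead (drop 2 v))).
      pose Gs := (fun (_ : baire) (v : seq nat) => nth 0 v 0) ::
        [seq (fun (_ : baire) (v : seq nat) => nth 0 v i) | i <- iota 3 k].
      apply: cpt_ext (@cpt_step_indexed _ _ _ k.+3 (fun _ v => nth 0 v 2) Gs hf _ _ _).
      * move=> p v sv; rewrite /= -map_comp -nth0 nth_drop; congr (Ef p _ (_ :: _)).
        by rewrite -!drop1 !drop_drop (@drop_map_nth 3 k).
      * exact: cpt_nth.
      * by rewrite /= size_map size_iota.
      * by constructor; [exact: cpt_nth | exact: Forall_cpt_nth].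
    apply: cpt_if; [exact: cpt_eq0 (cpt_nth _ 1) | | exact: cpt_nth].
    apply: cpt_if; [exact: cpt_eq0 | exact: cpt_const |].
    apply: cpt_if; [exact: cpt_eq0 (cpt_pred _) | | exact: cpt_const].
    by do 2!apply: cpt_succ; exact: cpt_nth.
- move=> p t t' v y le_t.
  case E: (search _ t) => [|[|z]] // [<-].
  move/search_found: E => [lt_zt /mf h1 hi].
  suff -> : search (fun y => Ef p t' (y :: v)) t' = z.+2 by [].
  apply/search_found; split; [exact: leq_trans le_t | exact: h1 |].
  by move=> i /hi; case E: (Ef p t _) => [|[|c]] // _; rewrite (mf _ _ _ _ _ le_t E).
- move=> p v y sv /= [h0 hs].
  have sc i : size (i :: v) = k.+1 by rewrite /= sv.
  have [t0 ht0] := cf _ _ _ (sc y) h0.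
  have [] := @exists_uniform_bound (fun i t => 1 < Ef p t (i :: v)) y.
  + move=> i m m' le_m; case E: (Ef p m _) => [|[|c]] // _.
    by rewrite (mf _ _ _ _ _ le_m E).
  + by move=> i /hs [c /(cf _ _ _ (sc i)) [t ht]]; exists t; rewrite ht.
  (* The bound must also exceed [y], since a search with bound [t] inspects only arguments below
     [t]. *)
  move=> t ht; exists (maxn y.+1 (maxn t0 t)).
  suff -> : search (fun y' => Ef p (maxn y.+1 (maxn t0 t)) (y' :: v))
     (maxn y.+1 (maxn t0 t)) = y.+2 by [].
  apply/search_found; split; first by rewrite leq_maxl.
    by apply: mf ht0; rewrite leq_max leq_maxl orbT.
  move=> i /ht; case E: (Ef p t _) => [|[|c]] // _.
  by rewrite (mf _ _ _ _ _ _ E) // leq_max leq_maxr orbT.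
Qed.

(** All arities are treated at once, because [Comp], [PrimRec] and [Mu] run their parts on lists of
    other lengths. *)
Lemma exists_step_indexed e k : exists E, step_indexed k e E.
Proof.
elim/program_nested_ind: e k => [|||||f g IHf IHg|f IHf] k.
- exists (fun _ _ _ => 1); split=> //; first exact: cpt_const.
  by move=> p v y _ /= ->; exists 0.
- exists (fun _ _ v => (head 0 v).+2); split=> //.
    do 2!apply: cpt_succ; apply: cpt_ext (cpt_nth _ 1) => p v _.
    by case: v => [|? []].
  by move=> p v y _ /= ->; exists 0.
- move=> n; exists (fun _ _ v => (nth 0 v k).+1); split=> //.
    by apply: cpt_succ; apply: cpt_ext (cpt_nth _ k.+1) => p [|? ?] //=; rewrite nth_nil.
  by move=> p v y _ /= ->; exists 0.
- exists (fun p _ v => (p (head 0 v)).+1); split=> //.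
    apply: cpt_succ; apply: cpt_oracle; apply: cpt_ext (cpt_nth _ 1) => p v _.
    by case: v => [|? []].
  by move=> p v y _ /= ->; exists 0.
- move=> gs IHf IHgs n; have [Ef hf] := IHf (size gs).
  have [Es hEs] : exists Es, List.Forall2 (step_indexed n) gs Es.
    elim: IHgs => [|g gs' /(_ n) [G hG] _ [Es hEs]]; first by exists [::]; constructor.
    by exists (G :: Es); constructor.
  eexists; exact: step_indexed_Comp hf hEs.
- have [Ef hf] := IHf k.-1; have [Eg hg] := IHg k.-1.+2.
  eexists; exact: step_indexed_PrimRec hf hg.
- have [Ef hf] := IHf k.+1; eexists; exact: step_indexed_Mu hf.
Qed.

(** Both outputs eventually appear in the same step-indexed evaluation, which never changes a
    positive value. *)
Lemma computes_det p e v y y' : computes p e v y -> computes p e v y' -> y = y'.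
Proof.
move=> hy hy'; have [E [_ mE cE]] := exists_step_indexed e (size v).
have [t ht] := cE _ _ _ erefl hy; have [t' ht'] := cE _ _ _ erefl hy'.
have := mE _ _ _ _ _ (leq_maxl t t') ht.
by rewrite (mE _ _ _ _ _ (leq_maxr t t') ht') => -[].
Qed.

(** * Computable maps on Baire space *)

Definition computable_fun (F : baire -> baire) := computable (fun p => Some (F p)).

Lemma computable_funE F : computable_fun F <-> cpt 1 (fun p v => F p (nth 0 v 0)).
Proof.
split=> -[e he]; exists e.
  by move=> p [|n [|]] //= _; exact: he.
by move=> p q [<-] n; exact: (he p [:: n]).
Qed.

Lemma cpt_fun k F A : computable_fun F -> cpt k A -> cpt k (fun p v => F p (A p v)).
Proof.
move=> /computable_funE hF hA.
by apply: (@cpt_comp 1 k (fun p v => F p (nth 0 v 0)) [:: A]) => //; do !constructor.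
Qed.

Lemma computable_comp F G :
  computable F -> computable G -> computable (fun p => obind G (F p)).
Proof.
move=> [e he] [e' he']; exists (oracle_subst e e') => p r.
case E: (F p) => [q|//] /= hr n.
apply: (@oracle_substP p q); last exact: he'.
exact: he.
Qed.

Lemma computable_fun_comp F G :
  computable_fun F -> computable_fun G -> computable_fun (G \o F).
Proof. exact: computable_comp. Qed.

Lemma computable_id : computable_fun id.
Proof. by apply/computable_funE; exact: cpt_oracle (cpt_nth _ 0). Qed.

(** The program for [F] still outputs [q n] when the oracle agrees with [p] far enough, and outputs
    are unique. *)
Lemma computable_continuous F p q n : computable F -> F p = Some q ->
  exists m, forall p' q', agree m p p' -> F p' = Some q' -> q' n = q n.
Proof.
move=> [e he] /he /(_ n) /computes_continuous [m hm]; exists m => p' q' /hm h hq'.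
by apply: computes_det h; exact: he.
Qed.

(** * Tagging and pairing of names, matching the sum and product representations *)

Definition bcons (c : nat) (p : baire) : baire := fun n => if n is n'.+1 then p n' else c.
Definition btail (p : baire) : baire := fun n => p n.+1.
Definition bpair (p q : baire) : baire := fun n => if odd n then q n./2 else p n./2.
Definition bfst (p : baire) : baire := fun n => p n.*2.
Definition bsnd (p : baire) : baire := fun n => p n.*2.+1.

Lemma bfst_pair p q : bfst (bpair p q) = p.
Proof. by apply/funext => n; rewrite /bfst /bpair odd_double doubleK. Qed.

Lemma bsnd_pair p q : bsnd (bpair p q) = q.
Proof. by apply/funext => n; rewrite /bsnd /bpair /= odd_double /= uphalf_double. Qed.

Lemma computable_bcons c F : computable_fun F -> computable_fun (fun p => bcons c (F p)).
Proof.
move=> hF; apply/computable_funE.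
apply: cpt_ext (cpt_if (cpt_eq0 (cpt_nth 1 0)) (cpt_const 1 c)
  (cpt_fun hF (cpt_pred (cpt_nth 1 0)))) => p v _.
by case: (nth 0 v 0).
Qed.

Lemma computable_btail : computable_fun btail.
Proof. by apply/computable_funE; exact: cpt_oracle (cpt_succ (cpt_nth _ 0)). Qed.

Lemma computable_bsucc : computable_fun (fun p => S \o p).
Proof. by apply/computable_funE; exact: cpt_succ (cpt_oracle (cpt_nth _ 0)). Qed.

Lemma computable_bpair F G :
  computable_fun F -> computable_fun G -> computable_fun (fun p => bpair (F p) (G p)).
Proof.
move=> hF hG; apply/computable_funE; have h0 := cpt_nth 1 0.
exact: cpt_if (cpt_odd h0) (cpt_fun hG (cpt_half h0)) (cpt_fun hF (cpt_half h0)).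
Qed.

Lemma computable_bfst : computable_fun bfst.
Proof.
apply/computable_funE; have h0 := cpt_nth 1 0.
apply: cpt_ext (cpt_oracle (cpt_add h0 h0)) => p v _.
by rewrite /bfst addnn.
Qed.

Lemma computable_bsnd : computable_fun bsnd.
Proof.
apply/computable_funE; have h0 := cpt_nth 1 0.
apply: cpt_ext (cpt_oracle (cpt_succ (cpt_add h0 h0))) => p v _.
by rewrite /bsnd addnn.
Qed.

Lemma computable_lookup s : computable_fun (fun=> nth 0 s).
Proof. by apply/computable_funE; exact: cpt_lookup (cpt_nth _ 0). Qed.

Lemma computable_const0 : computable_fun (fun=> fun=> 0).
Proof. by apply/computable_funE; exact: cpt_const. Qed.

(** Case distinction on the tag of a sum name, total because every nonzero tag counts as the second
    case. *)
Lemma computable_case F G : computable_fun F -> computable_fun G ->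
  computable_fun (fun p => if p 0 == 0 then F (btail p) else G (btail p)).
Proof.
move=> hF hG; apply/computable_funE.
have [hF' hG'] := (computable_fun_comp computable_btail hF,
                   computable_fun_comp computable_btail hG).
apply: cpt_ext (cpt_if (cpt_eq0 (cpt_oracle (cpt_const 1 0)))
  (cpt_fun hF' (cpt_nth 1 0)) (cpt_fun hG' (cpt_nth 1 0))) => p v _ /=.
by case: eqP.
Qed.

(** * The operation $p-1$ and its use for making partial maps total *)

Lemma minus1_wordS p n :
  minus1_word p n.+1 = minus1_word p n ++ (if p n is k.+1 then [:: k] else [::]).
Proof. by rewrite -addn1 minus1_wordD /=; case: (p n). Qed.

Lemma minus1_word_prefix p n m : n <= m -> prefix (minus1_word p n) (minus1_word p m).
Proof. by move=> /subnKC <-; rewrite minus1_wordD prefix_prefix. Qed.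

Lemma minus1_P p q : minus1 p = Some q <-> is_minus1 p q.
Proof.
split; last exact: minus1_eq.
by rewrite /minus1 /partial_of_rel; case: pselect => // h [<-]; case: (cid h).
Qed.

Lemma minus1_bcons c p : minus1 (bcons c.+1 p) = omap (bcons c) (minus1 p).
Proof.
have hw n : minus1_word (bcons c.+1 p) n.+1 = c :: minus1_word p n.
  by rewrite /minus1_word /mkseq /= -[iota 1 n]/(iota (1 + 0) n) iotaDl -map_comp.
have hm q m : mkseq (bcons c q) m.+1 = c :: mkseq q m.
  by rewrite /mkseq /= -[iota 1 m]/(iota (1 + 0) m) iotaDl -map_comp.
case E: (minus1 p) => [q|] /=.
  move/minus1_P: E => hq; apply/minus1_P => -[|m].
    by exists 0; rewrite prefix0s.
  by have [n hn] := hq m; exists n.+1; rewrite hm hw /= eqxx.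
case E': (minus1 (bcons c.+1 p)) => [q|//]; move/minus1_P: E' => hq.
have : is_minus1 p (btail q); last by move/minus1_eq; rewrite E.
move=> m; have [[|n]] := hq m.+1; first by rewrite /minus1_word.
rewrite hw; have -> : mkseq q m.+1 = q 0 :: mkseq (btail q) m.
  by rewrite /mkseq /= -[iota 1 m]/(iota (1 + 0) m) iotaDl -map_comp.
by move=> /= /andP [_]; exists n.
Qed.

(** Digit [n] is found by searching for the least [m] such that the first [m.+1] entries of [p]
    leave more than [n] digits. [F] tests this on the arguments [m] and [n]: the truncated
    difference is then 0. The digit is the predecessor of entry [m]. *)
Lemma computable_minus1 : computable minus1.
Proof.
pose F (p : baire) (v : seq nat) := (nth 0 v 1).+1 - size (minus1_word p (nth 0 v 0).+1).
have [eF heF] : cpt 2 F.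
  apply: cpt_subn; first exact: cpt_succ (cpt_nth _ 1).
  have hs := cpt_add (cpt_nth 4 1) (cpt_neq0 (cpt_oracle (cpt_nth 4 0))).
  apply: cpt_ext (cpt_iteri (S := fun p i s _ => s + (p i != 0))
    (cpt_succ (cpt_nth 2 0)) (cpt_const 2 0) hs) => p v _.
  elim: (_.+1) => [|n IH] //; rewrite iteriS IH minus1_wordS size_cat.
  by case: (p n).
have [eo heo] : cpt 1 (fun p v => (p (nth 0 v 0)).-1).
  exact: cpt_pred (cpt_oracle (cpt_nth _ 0)).
exists (Comp eo [:: Mu eF]) => p q /minus1_P hq n; apply/computes_Comp.
have ex : exists m, n < size (minus1_word p m.+1).
  have [m hm] := hq n.+1; exists m.
  have := size_prefix hm.
  rewrite size_mkseq => /leq_trans; apply.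
  exact: size_prefix (minus1_word_prefix _ _).
case: (ex_minnP ex) => m hm min_m; exists [:: m].
  constructor; last by constructor.
  split; first by have := heF p [:: m; n] erefl; rewrite /F /= (eqP hm).
  move=> i lt_im; exists (F p [:: i; n]).-1.
  rewrite prednK; first exact: heF.
  by rewrite /F /= subn_gt0 ltnNge; apply/negP => /min_m; rewrite leqNgt lt_im.
(* By minimality the first [m] entries leave at most [n] digits, so digit [n] comes from entry
   [m]. *)
have sm : size (minus1_word p m) <= n.
  case: m hm min_m => [|m] _ min_m; first by [].
  by rewrite leqNgt; apply/negP => /min_m; rewrite ltnn.
suff -> : q n = (p m).-1 by exact: (heo p [:: m]).
have nth_n k : n < size (minus1_word p k) -> nth 0 (minus1_word p k) n = q n.
  move=> lt_n; have [k' hk'] := hq n.+1.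
  have h1 : prefix (mkseq q n.+1) (minus1_word p (maxn k k')).
    by apply: prefix_trans hk' _; apply: minus1_word_prefix; rewrite leq_maxr.
  have /prefixP [s2 h2] := minus1_word_prefix p (leq_maxl k k').
  case/prefixP: h1 => s1; rewrite h2 => /(congr1 (fun s => nth 0 s n)).
  by rewrite !nth_cat lt_n size_mkseq ltnSn nth_mkseq.
have lt_nF : (n < size (minus1_word p m)) = false by rewrite ltnNge sm.
rewrite -(nth_n m.+1 hm); move: hm; rewrite minus1_wordS size_cat nth_cat lt_nF.
case: (p m) => [|k] /=; first by rewrite addn0 lt_nF.
rewrite addn1 ltnS => le_n; suff -> : n - size (minus1_word p m) = 0 by [].
by apply/eqP; rewrite subn_eq0.
Qed.

(* [G p] lists the digits of [F p], printing [0] as long as the next digit has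
   not been computed. *)
Lemma minus1_totalization F : computable F ->
  exists2 G, computable_fun G & forall p q, F p = Some q -> minus1 (G p) = minus1 q.
Proof.
move=> [e he]; have [E hE] := exists_step_indexed e 1; have [_ mE cE] := hE.
(* The number of digits printed before stage [t], hence the index of the digit being computed at
   stage [t]. *)
pose idx p t := iteri t (fun t' i => i + (E p t' [:: i] != 0)) 0.
have cpt_E m T I : cpt m T -> cpt m I -> cpt m (fun p v => E p (T p v) [:: I p v]).
  move=> hT hI; apply: (@cpt_step_indexed _ _ _ m T [:: I] hE hT) => //.
  by do !constructor.
exists (fun p t => (E p t [:: idx p t]).-1).
  apply/computable_funE; apply: cpt_pred; apply: (cpt_E); first exact: cpt_nth.
  have hs := cpt_add (cpt_nth 3 1) (cpt_neq0 (cpt_E _ _ _ (cpt_nth 3 0) (cpt_nth 3 1))).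
  exact: (cpt_iteri (S := fun p t' i _ => i + (E p t' [:: i] != 0))
    (cpt_nth 1 0) (cpt_const 1 0) hs).
move=> p q /he hq; set G := fun t : nat => _.
have idxS t : idx p t.+1 = idx p t + (E p t [:: idx p t] != 0) by [].
have E_eq t n y : E p t [:: n] = y.+1 -> y = q n.
  move=> hy; have [t' ht'] := cE p [:: n] _ erefl (hq n).
  have := mE _ _ _ _ _ (leq_maxl t t') hy.
  by rewrite (mE _ _ _ _ _ (leq_maxr t t') ht') => -[].
(* The zeros printed while waiting contribute the empty word. *)
have wordG t : minus1_word G t = minus1_word q (idx p t).
  elim: t => [|t IH] //; rewrite minus1_wordS IH idxS /G.
  case Et: (E p t _) => [|y] /=; first by rewrite cats0 addn0.
  by rewrite addn1 minus1_wordS -(E_eq _ _ _ Et).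
have idx_mono t t' : t <= t' -> idx p t <= idx p t'.
  by move=> /subnKC <-; elim: (t' - t) => [|d IH]; rewrite ?addn0 // addnS idxS
    (leq_trans IH) // leq_addr.
have idx_unbounded m : exists t, m <= idx p t.
  elim: m => [|m [t ht]]; first by exists 0.
  have [t' ht'] := cE p [:: m] _ erefl (hq m); pose T := maxn t t'; exists T.+1.
  have := leq_trans ht (idx_mono _ _ (leq_maxl t t')).
  rewrite leq_eqVlt => /orP [/eqP eq_m|lt_m].
    by rewrite idxS -eq_m (mE _ _ _ _ _ (leq_maxr t t') ht') addn1.
  by apply: leq_trans lt_m (idx_mono _ _ _).
suff -> : minus1 G = minus1 q by [].
(* Both sides may be undefined, so the defining relations are identified instead of their values. *)
rewrite /minus1 /partial_of_rel.
suff -> : is_minus1 G = is_minus1 q by [].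
apply/funext => r; apply/propext; split=> h m; have [n hn] := h m.
  by exists (idx p n); rewrite -wordG.
have [t ht] := idx_unbounded n; exists t; rewrite wordG.
exact: prefix_trans hn (minus1_word_prefix _ ht).
Qed.

(** * Reducibility through solution relations *)

Lemma total_computable (F : baire -> option baire) : computable F -> Defs.total F ->
  exists2 G, computable_fun G & forall p, F p = Some (G p).
Proof.
move=> hF tF; have hG p : F p = Some (odflt p (F p)).
  by case: (F p) (tF p) => // /(_ erefl).
exists (fun p => odflt p (F p)) => //.
rewrite /computable_fun; suff <- : F = (fun p => Some (odflt p (F p))) by [].
exact/funext.
Qed.

Lemma precompleteP (X : Type) (d : representation X) (F : baire -> option baire) :
  precomplete d -> computable F ->
  exists2 G, computable_fun G & forall p q, F p = Some q -> d (G p) = d q.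
Proof.
move=> pd hF; have [G [hG tG FG]] := pd _ hF.
have [G' hG' GG'] := total_computable hG tG; exists G' => // p q Fp.
by have := FG p; rewrite Fp GG' /= => ->.
Qed.

Lemma precomplete_ofP (X : Type) (d : representation X) :
  (forall F, computable F ->
    exists2 G, computable_fun G & forall p q, F p = Some q -> d (G p) = d q) ->
  precomplete d.
Proof.
move=> h F /h [G hG FG]; exists (fun p => Some (G p)); split=> // p.
by case E: (F p) => [q|//] _ /=; rewrite (FG _ _ E).
Qed.

(** * Precomplete representations and translations between them *)

Lemma precompletion_surj (X : repspace) (x : X) :
  exists p, precompletion (delta X) p = Some x.
Proof.
by have [p hp] := rep_surj (delta X) x; exists (S \o p); rewrite /precompletion minus1_S.
Qed.

Definition wp (X : repspace) : representation X := Representation (@precompletion_surj X).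

Lemma wpE (X : repspace) p : wp X p = obind (delta X) (minus1 p).
Proof. by []. Qed.

(** A partial map becomes total by printing zeros while it waits, which $\delta_X^\wp$ does not see.
    The translations are $p\mapsto p-1$ and the increment of every digit. *)
Lemma wp_variant X : precomplete_variant (wp X).
Proof.
split.
  apply: precomplete_ofP => F /minus1_totalization [G hG FG].
  by exists G => // p q /FG; rewrite !wpE => ->.
split.
  by exists minus1; first exact: computable_minus1.
exists (fun p => Some (S \o p)); first exact: computable_bsucc.
by move=> p _; rewrite /= /precompletion minus1_S.
Qed.

Lemma variant_refl (X : repspace) : precomplete (delta X) -> precomplete_variant (delta X).
Proof. by split=> //; split; exists (fun p => Some p) => //; exact: computable_id. Qed.

Lemma completion_precomplete X : precomplete (delta (completion X)).
Proof.
apply: precomplete_ofP => F /minus1_totalization [G hG FG].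
by exists G => // p q /FG; rewrite /= /completion_rep /precompletion => ->.
Qed.

Lemma prod_variant (X Y : repspace) :
  precomplete (delta X) -> precomplete (delta Y) ->
  precomplete_variant (delta (prod_space X Y)).
Proof.
move=> pX pY; apply: variant_refl; apply: precomplete_ofP => F hF.
have [G1 hG1 FG1] := precompleteP pX (computable_comp hF computable_bfst).
have [G2 hG2 FG2] := precompleteP pY (computable_comp hF computable_bsnd).
exists (fun p => bpair (G1 p) (G2 p)); first exact: computable_bpair.
move=> p q Fp; rewrite /= /prod_rep -/(bfst _) -/(bsnd _) -/(bfst q) -/(bsnd q).
by rewrite bfst_pair bsnd_pair (FG1 _ (bfst q)) ?Fp // (FG2 _ (bsnd q)) ?Fp.
Qed.

(** Going through the given representation yields a partial translation, which precompleteness of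
    [d'] makes total. *)
Lemma variant_translation (X : repspace) (d d' : representation X) :
  precomplete_variant d -> precomplete_variant d' ->
  exists2 T, computable_fun T & forall p x, d p = Some x -> d' (T p) = Some x.
Proof.
move=> [_ [[F hF dF] _]] [pd' [_ [F' hF' dF']]].
have [G hG FG] := precompleteP pd' (computable_comp hF hF').
have Some_neq (x : X) : Some x <> None by [].
exists G => // p x dp; have := dF p; rewrite dp => /(_ (Some_neq x)).
case E: (F p) => [q|] //= dq; have := dF' q; rewrite dq => /(_ (Some_neq x)).
by case E': (F' q) => [q'|] //= <-; apply: FG; rewrite E.
Qed.

(** * Solutions, and independence of the chosen precomplete representations *)

Definition sol (f : problem) (dX : representation (source f))
    (dY : representation (target f)) (p q : baire) : Prop :=
  forall x, dX p = Some x -> dom f x -> exists2 y, dY q = Some y & f x y.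

Lemma sol_exists f dX dY p : exists q, @sol f dX dY p q.
Proof.
case E: (dX p) => [x|]; last by exists p => x; rewrite E.
case: (pselect (dom f x)) => [[y fxy]|ndom]; last first.
  by exists p => x'; rewrite E => -[<-].
have [q hq] := rep_surj dY y; exists q => x'; rewrite E => -[<-] _.
by exists y.
Qed.

Lemma total_realizerP f dX dY (G : baire -> baire) :
  (forall p, @sol f dX dY p (G p)) -> total_realizer dX dY (fun p => Some (G p)).
Proof. by move=> h; split=> // p x; exact: h. Qed.

(* The total realizers of [g] are the selections of its solution relation, so
   quantifying over all of them amounts to the pointwise condition below. *)
Definition sol_reducible (f g : problem)
    (dX : representation (source f)) (dY : representation (target f))
    (dU : representation (source g)) (dV : representation (target g)) : Prop :=
  exists H K : baire -> baire, [/\ computable_fun H, computable_fun K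
    & forall p q, sol dU dV (K p) q -> sol dX dY p (H q)].

(** For the forward direction, a given solution of one instance is extended by arbitrary solutions
    elsewhere to a total realizer of [g]; the reduction applied to it yields the required solution
    for [f]. [A], [B], [C] and [D] translate between the representations of the reduction and those
    of the statement. *)
Lemma stW_leP f g
    (dX : representation (source f)) (dY : representation (target f))
    (dU : representation (source g)) (dV : representation (target g)) :
  precomplete_variant dX -> precomplete_variant dY ->
  precomplete_variant dU -> precomplete_variant dV ->
  stW_le f g <-> sol_reducible dX dY dU dV.
Proof.
move=> vX vY vU vV; split; last first.
  move=> [H [K [hH hK HK]]]; exists dX, dY, dU, dV; split=> //.
  exists (fun p => Some (H p)), (fun p => Some (K p)); split=> // G [tG rG].
  split=> [p|p x dp domx] /=; first by case E: (G (K p)) => [//|]; case: (tG _ E).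
  case E: (G (K p)) => [q|]; last by case: (tG _ E).
  apply: HK dp domx => u du domu.
  by have := rG _ _ du domu; rewrite E.
move=> [dX' [dY' [dU' [dV' [vX' vY' vU' vV' [H [K [hH hK HK]]]]]]]].
have [A hA XA] := variant_translation vX vX'.
have [B hB YB] := variant_translation vY' vY.
have [C hC UC] := variant_translation vU' vU.
have [D hD VD] := variant_translation vV vV'.
have /choice [G0 hG0] := @sol_exists g dU' dV'.
(* The composite with a total realizer is total, which forces [K] to be total. *)
have [K' hK' KK'] : exists2 K', computable_fun K' & forall p, K p = Some (K' p).
  apply: total_computable => // p Kp.
  by have [/(_ p)] := HK _ (total_realizerP hG0); rewrite Kp.
have [pY _] := vY.
(* [H] may diverge on sequences that are no answers; precompleteness of [dY] supplies a total
   replacement. *)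
have [H' hH' HH'] :=
  precompleteP pY (computable_comp (computable_comp hD hH) hB).
exists H', (C \o K' \o A); split=> //.
  by do 2!apply: computable_fun_comp => //.
move=> p q solq.
(* The realizer need not be computable, so it may be altered at the single instance in question. *)
pose G r := if pselect (r = K' (A p)) is left _ then D q else G0 r.
have hG r : sol dU' dV' r (G r).
  rewrite /G; case: pselect => [-> u du domu|_]; last exact: hG0.
  have [v dv guv] := solq u (UC _ _ du) domu.
  by exists v => //; exact: VD.
have [tHK rHK] := HK _ (total_realizerP hG).
have GA : G (K' (A p)) = D q by rewrite /G; case: pselect => // -[].
move=> x dx domx; have /= := rHK (A p) x (XA _ _ dx) domx.
rewrite KK' /= GA; case E: (H (D q)) => [r|] /= [y] // dr fxy; exists y => //.
by rewrite (HH' _ (B r)) /= ?E //; exact: YB.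
Qed.

Lemma stW_leE f g : stW_le f g <-> sol_reducible (wp (source f)) (wp (target f))
  (wp (source g)) (wp (target g)).
Proof. by apply: stW_leP; exact: wp_variant. Qed.

Lemma stW_le_refl f : stW_le f f.
Proof. by apply/stW_leE; exists id, id; split=> //; exact: computable_id. Qed.

Lemma stW_le_trans g f h : stW_le f g -> stW_le g h -> stW_le f h.
Proof.
move=> /stW_leE [H [K [hH hK HK]]] /stW_leE [H' [K' [hH' hK' HK']]].
apply/stW_leE; exists (H \o H'), (K' \o K); split; try exact: computable_fun_comp.
by move=> p q /HK' /HK.
Qed.

(** * Infima and suprema *)

Definition meetp (f g : problem) := sqcap (completion_problem f) (completion_problem g).

Lemma dom_completion f x : dom (completion_problem f) x.
Proof.
case: x => [x|]; last by exists None.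
case: (pselect (dom f x)) => [[y fxy]|ndom]; last by exists None.
by exists (Some y) => _; exists y.
Qed.

(** The value of [wp] is an option, hence a point of the completion, with [None] as $\bot$. Both
    sides hold trivially at $\bot$ and outside the domain of [f]. *)
Lemma completion_problemP f p q :
  completion_problem f (wp (source f) p) (wp (target f) q) <->
  sol (wp (source f)) (wp (target f)) p q.
Proof.
rewrite /sol; case: (wp _ p) => [x|] /=; split=> //.
- by move=> h x' [<-] /h [y ->]; exists y.
- by move=> h /(h x erefl) [y]; exists y.
Qed.

(** A product of completions is precomplete as it stands; the sum, whose names show the tag at once,
    is replaced by its precompletion. *)
Definition meet_source f g : representation (source (meetp f g)) := delta _.
Definition meet_target f g : representation (target (meetp f g)) := wp _.

Lemma meet_source_variant f g : precomplete_variant (meet_source f g).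
Proof. by apply: prod_variant; exact: completion_precomplete. Qed.

Lemma meet_target_variant f g : precomplete_variant (meet_target f g).
Proof. exact: wp_variant. Qed.

(** Completed problems are total, so every [p] names a point of the domain and a solution must
    reveal a tag. *)
Lemma sol_meet f g p q : sol (meet_source f g) (meet_target f g) p q <->
  exists2 s, minus1 q = Some s &
    s 0 = 0 /\ sol (wp (source f)) (wp (target f)) (bfst p) (btail s) \/
    s 0 = 1 /\ sol (wp (source g)) (wp (target g)) (bsnd p) (btail s).
Proof.
have dp : meet_source f g p = Some (wp _ (bfst p), wp _ (bsnd p)) by [].
split.
  move=> /(_ _ dp) []; first have [y hy] := @dom_completion f (wp _ (bfst p)).
    by exists (inl y); split=> //; exact: dom_completion.
  move=> z; rewrite /meet_target wpE; case: (minus1 q) => [s|//] /=.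
  rewrite /sum_rep -/(btail s) => dz hz; exists s => //; move: dz hz.
  case: (s 0) => [|[|]] //= -[<-] /=.
    by case=> _ _ /completion_problemP; left.
  by case=> _ _ /completion_problemP; right.
move=> [s qs hs] x; rewrite dp => -[<-] _.
rewrite /meet_target wpE qs /= /sum_rep -/(btail s).
case: hs => -[-> /completion_problemP hs] /=; eexists; try by [].
  by split; [exact: dom_completion..|].
by split; [exact: dom_completion..|].
Qed.

Definition join_source f g : representation (source (boxplus f g)) := wp _.
Definition join_target f g : representation (target (boxplus f g)) := delta _.

Lemma join_source_variant f g : precomplete_variant (join_source f g).
Proof. exact: wp_variant. Qed.

Lemma join_target_variant f g : precomplete_variant (join_target f g).
Proof. by apply: prod_variant; exact: completion_precomplete. Qed.

Lemma sol_join f g p q : sol (join_source f g) (join_target f g) p q <->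
  forall s, minus1 p = Some s ->
    (s 0 = 0 -> sol (delta (source f)) (wp (target f)) (btail s) (bfst q)) /\
    (s 0 = 1 -> sol (delta (source g)) (wp (target g)) (btail s) (bsnd q)).
Proof.
have dq : join_target f g q = Some (wp _ (bfst q), wp _ (bsnd q)) by [].
split.
  move=> + s ps; rewrite /sol /join_source wpE ps /= /sum_rep -/(btail s) => h.
  split=> s0 x dx; rewrite s0 in h.
    move=> [y fxy]; have := h (inl x); rewrite dx => /(_ erefl) [|z].
      (* The component that is not asked for may be $\bot$. *)
      by exists (Some y, None); exists y.
    by rewrite [LHS]dq => -[<-] [y' e fxy']; exists y'.
  move=> [y fxy]; have := h (inr x); rewrite dx => /(_ erefl) [|z].
    by exists (None, Some y); exists y.
  by rewrite [LHS]dq => -[<-] [y' e fxy']; exists y'.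
move=> h x; rewrite /join_source wpE; case: (minus1 p) (h) => [s|//] /(_ s erefl) /=.
rewrite /sum_rep -/(btail s).
case: (s 0) => [|[|]] //= [h0 h1].
  case E: (delta _ (btail s)) => [x'|] //= [<-] [z [y _ fxy]].
  have [|y' e fxy'] := h0 erefl _ E; first by exists y.
  by eexists; [exact: dq|exists y'].
case E: (delta _ (btail s)) => [x'|] //= [<-] [z [y _ fxy]].
have [|y' e fxy'] := h1 erefl _ E; first by exists y.
by eexists; [exact: dq|exists y'].
Qed.

Lemma sol_wp_source f dY p s q : minus1 p = Some s ->
  sol (wp (source f)) dY p q = @sol f (delta (source f)) dY s q.
Proof. by move=> ps; rewrite /sol wpE ps. Qed.

Lemma sol_eq_target f dX (dY : representation (target f)) p q q' :
  dY q = dY q' -> sol dX dY p q -> sol dX dY p q'.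
Proof. by rewrite /sol => ->. Qed.

Lemma sol_eq_source f (dX : representation (source f)) dY p p' q :
  dX p = dX p' -> sol dX dY p q -> sol dX dY p' q.
Proof. by rewrite /sol => ->. Qed.

Lemma meet_lel f g : stW_le (meetp f g) f.
Proof.
apply/(stW_leP (meet_source_variant f g) (meet_target_variant f g)
  (wp_variant _) (wp_variant _)).
exists (fun q => S \o bcons 0 q), bfst; split.
- by apply: computable_fun_comp computable_bsucc; exact: computable_bcons computable_id.
- exact: computable_bfst.
- by move=> p q solq; apply/sol_meet; exists (bcons 0 q); [rewrite minus1_S | left].
Qed.

Lemma meet_ler f g : stW_le (meetp f g) g.
Proof.
apply/(stW_leP (meet_source_variant f g) (meet_target_variant f g)
  (wp_variant _) (wp_variant _)).
exists (fun q => S \o bcons 1 q), bsnd; split.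
- by apply: computable_fun_comp computable_bsucc; exact: computable_bcons computable_id.
- exact: computable_bsnd.
- by move=> p q solq; apply/sol_meet; exists (bcons 1 q); [rewrite minus1_S | right].
Qed.

(** The tag of the answer decides between the two reductions. It appears only after the padding is
    removed, so precompleteness on the side of [h] is needed to make the case distinction total. *)
Lemma meet_glb h f g : stW_le h f -> stW_le h g -> stW_le h (meetp f g).
Proof.
move=> /stW_leE [H1 [K1 [hH1 hK1 HK1]]] /stW_leE [H2 [K2 [hH2 hK2 HK2]]].
apply/(stW_leP (wp_variant _) (wp_variant _)
  (meet_source_variant f g) (meet_target_variant f g)).
have [H hH HE] := precompleteP (proj1 (wp_variant (target h)))
  (computable_comp computable_minus1 (computable_case hH1 hH2)).
exists H, (fun p => bpair (K1 p) (K2 p)); split=> //; first exact: computable_bpair.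
move=> p q /sol_meet [s qs]; rewrite bfst_pair bsnd_pair.
have := HE q; rewrite qs /= => /(_ _ erefl) e.
by case=> -[s0]; [move/HK1 | move/HK2]; apply: sol_eq_target; rewrite [RHS]e s0.
Qed.

Lemma join_gel f g : stW_le f (boxplus f g).
Proof.
apply/(stW_leP (wp_variant _) (wp_variant _)
  (join_source_variant f g) (join_target_variant f g)).
(* Under $p-1$ the digit 1 is the tag 0. *)
exists bfst, (bcons 1); split; first exact: computable_bfst.
  exact: computable_bcons computable_id.
move=> p q /sol_join; rewrite minus1_bcons.
case ps: (minus1 p) => [s|] /=; last by move=> _ x; rewrite wpE ps.
by move=> /(_ _ erefl) [/(_ erefl) + _]; rewrite (sol_wp_source _ _ ps).
Qed.

Lemma join_ger f g : stW_le g (boxplus f g).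
Proof.
apply/(stW_leP (wp_variant _) (wp_variant _)
  (join_source_variant f g) (join_target_variant f g)).
(* Under $p-1$ the digit 2 is the tag 1. *)
exists bsnd, (bcons 2); split; first exact: computable_bsnd.
  exact: computable_bcons computable_id.
move=> p q /sol_join; rewrite minus1_bcons.
case ps: (minus1 p) => [s|] /=; last by move=> _ x; rewrite wpE ps.
by move=> /(_ _ erefl) [_ /(_ erefl)]; rewrite (sol_wp_source _ _ ps).
Qed.

(** The answer map does not see the tag and prepares a candidate for either problem; only the
    instance map distinguishes cases. *)
Lemma join_lub h f g : stW_le f h -> stW_le g h -> stW_le (boxplus f g) h.
Proof.
move=> /stW_leE [H1 [K1 [hH1 hK1 HK1]]] /stW_leE [H2 [K2 [hH2 hK2 HK2]]].
apply/(stW_leP (join_source_variant f g) (join_target_variant f g)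
  (wp_variant _) (wp_variant _)).
(* [K1] and [K2] expect padded names, while the tag is read off the unpadded one; [S] pads again. *)
have hS F : computable_fun F -> computable_fun (fun p => F (S \o p)).
  by move=> hF; exact: (computable_fun_comp computable_bsucc hF).
have [K hK KE] := precompleteP (proj1 (wp_variant (source h)))
  (computable_comp computable_minus1 (computable_case (hS _ hK1) (hS _ hK2))).
exists (fun q => bpair (H1 q) (H2 q)), K; split=> //; first exact: computable_bpair.
move=> p q solq; apply/sol_join => s ps; rewrite bfst_pair bsnd_pair.
have e : wp (source h) (K p) =
    wp (source h) (if s 0 == 0 then K1 (S \o btail s) else K2 (S \o btail s)).
  by apply: KE; rewrite ps.
split=> s0; rewrite s0 in e.
  have /HK1 := sol_eq_source e solq.
  by rewrite (sol_wp_source _ _ (minus1_S _)).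
have /HK2 := sol_eq_source e solq.
by rewrite (sol_wp_source _ _ (minus1_S _)).
Qed.

(** * The lattice of degrees *)

HB.instance Definition _ := gen_eqMixin degree.
HB.instance Definition _ := gen_choiceMixin degree.

Definition repr_problem (D : degree) : problem := projT1 (cid (membersP D)).

Lemma deg_ext (D D' : degree) : members D = members D' -> D = D'.
Proof.
case: D D' => m mP [m' mP'] /= e; rewrite e in mP *.
by congr Degree; exact: Prop_irrelevance.
Qed.

Lemma deg_eq f g : deg f = deg g <-> stW_equiv f g.
Proof.
split=> [e|[fg gf]].
  have : members (deg f) g by rewrite e; split; exact: stW_le_refl.
  by [].
apply: deg_ext; apply/seteqP; split=> h [h1 h2]; split.
- exact: stW_le_trans gf h1.
- exact: stW_le_trans h2 fg.
- exact: stW_le_trans fg h1.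
- exact: stW_le_trans h2 gf.
Qed.

Lemma repr_problemK D : deg (repr_problem D) = D.
Proof. by apply: deg_ext; rewrite /repr_problem; case: cid. Qed.

Lemma repr_problem_deg f : stW_equiv (repr_problem (deg f)) f.
Proof. by apply/deg_eq; rewrite repr_problemK. Qed.

Definition deg_le (D D' : degree) : bool := `[< stW_le (repr_problem D) (repr_problem D') >].
Definition deg_meet (D D' : degree) : degree := deg (meetp (repr_problem D) (repr_problem D')).
Definition deg_join (D D' : degree) : degree := deg (boxplus (repr_problem D) (repr_problem D')).

Lemma deg_leE f g : deg_le (deg f) (deg g) = `[< stW_le f g >].
Proof.
have [f1 f2] := repr_problem_deg f; have [g1 g2] := repr_problem_deg g.
apply/asboolP/asboolP => h.
  exact: stW_le_trans f2 (stW_le_trans h g1).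
exact: stW_le_trans f1 (stW_le_trans h g2).
Qed.

Lemma deg_le_refl : reflexive deg_le.
Proof. by move=> D; apply/asboolP; exact: stW_le_refl. Qed.

Lemma deg_le_anti : antisymmetric deg_le.
Proof.
move=> D D' /andP [/asboolP h /asboolP h'].
by rewrite -(repr_problemK D) -(repr_problemK D'); apply/deg_eq.
Qed.

Lemma deg_le_trans : transitive deg_le.
Proof.
by move=> D' D D'' /asboolP h /asboolP h'; apply/asboolP; exact: stW_le_trans h h'.
Qed.

Fact degree_display : Order.disp_t. Proof. exact: Order.Disp tt tt. Qed.

HB.instance Definition _ :=
  Order.Le_isPOrder.Build degree_display degree deg_le_refl deg_le_anti deg_le_trans.

Lemma deg_meetP (x y z : degree) : (x <= deg_meet y z)%O = (x <= y)%O && (x <= z)%O.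
Proof.
rewrite -(repr_problemK x) -{2}(repr_problemK y) -{2}(repr_problemK z).
rewrite /deg_meet !/(Order.le _ _) /= !deg_leE.
apply/asboolP/andP => [h|[/asboolP h1 /asboolP h2]]; last exact: meet_glb.
split; apply/asboolP; first exact: stW_le_trans h (meet_lel _ _).
exact: stW_le_trans h (meet_ler _ _).
Qed.

Lemma deg_joinP (x y z : degree) : (deg_join x y <= z)%O = (x <= z)%O && (y <= z)%O.
Proof.
rewrite -(repr_problemK z) -{2}(repr_problemK x) -{2}(repr_problemK y).
rewrite /deg_join !/(Order.le _ _) /= !deg_leE.
apply/asboolP/andP => [h|[/asboolP h1 /asboolP h2]]; last exact: join_lub.
split; apply/asboolP; first exact: stW_le_trans (join_gel _ _) h.
exact: stW_le_trans (join_ger _ _) h.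
Qed.

HB.instance Definition _ :=
  Order.POrder_MeetJoin_isLattice.Build degree_display degree deg_meetP deg_joinP.

Lemma leE_deg f g : (deg f <= deg g)%O <-> stW_le f g.
Proof. by rewrite /Order.le /= deg_leE; split=> /asboolP. Qed.

(** The operation on degrees uses chosen representatives; as both sides are greatest lower bounds,
    the choice does not matter. *)
Lemma meetE_deg f g : (deg f `&` deg g)%O = deg (meetp f g).
Proof.
have [f1 f2] := repr_problem_deg f; have [g1 g2] := repr_problem_deg g.
apply/deg_eq; split; apply: meet_glb.
- exact: stW_le_trans (meet_lel _ _) f1.
- exact: stW_le_trans (meet_ler _ _) g1.
- exact: stW_le_trans (meet_lel _ _) f2.
- exact: stW_le_trans (meet_ler _ _) g2.
Qed.

Lemma joinE_deg f g : (deg f `|` deg g)%O = deg (boxplus f g).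
Proof.
have [f1 f2] := repr_problem_deg f; have [g1 g2] := repr_problem_deg g.
apply/deg_eq; split; apply: join_lub.
- exact: stW_le_trans f1 (join_gel _ _).
- exact: stW_le_trans g1 (join_ger _ _).
- exact: stW_le_trans f2 (join_gel _ _).
- exact: stW_le_trans g2 (join_ger _ _).
Qed.

(** * Failure of distributivity *)

(** Generic trees over [nat] are countable, so this embedding yields an injective numbering of
    programs; its computability is irrelevant. *)
Fixpoint tree_of_program (e : program) : GenTree.tree nat :=
  match e with
  | Zero => GenTree.Node 0 [::]
  | Succ => GenTree.Node 1 [::]
  | Proj i => GenTree.Leaf i
  | Oracle => GenTree.Node 2 [::]
  | Comp f gs => GenTree.Node 3 (tree_of_program f :: [seq tree_of_program g | g <- gs])
  | PrimRec f g => GenTree.Node 4 [:: tree_of_program f; tree_of_program g]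
  | Mu f => GenTree.Node 5 [:: tree_of_program f]
  end.

Lemma tree_of_program_inj : injective tree_of_program.
Proof.
move=> e; elim/program_nested_ind: e => [||i||f gs IHf IHgs|f g IHf IHg|f IHf] [||j||f' gs'|f' g'|f'] //=.
- by case=> ->.
- case=> /IHf <- egs; congr Comp.
  elim: IHgs gs' egs => [|g gs0 IHg _ IH] [|g' gs'] //= [/IHg -> /IH ->] //.
- by case=> /IHf <- /IHg <-.
- by case=> /IHf <-.
Qed.

Definition program_code (e : program) : nat := pickle (tree_of_program e).

Lemma program_code_inj : injective program_code.
Proof. exact: inj_comp (pcan_inj pickleK) tree_of_program_inj. Qed.

(** * Turing reducibility and sequences not computable in a given one *)

Definition computable_in (p q : baire) : Prop :=
  exists e, forall n, computes p e [:: n] (q n).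

Lemma computable_in_trans q p r :
  computable_in p q -> computable_in q r -> computable_in p r.
Proof.
move=> [e he] [e' he']; exists (oracle_subst e e') => n.
exact: oracle_substP (he' n).
Qed.

Lemma computable_in_image F p q : computable F -> F p = Some q -> computable_in p q.
Proof. by move=> [e he] Fp; exists e; exact: he. Qed.

Lemma computable_in_fun F p : computable_fun F -> computable_in p (F p).
Proof. by move=> hF; exact: computable_in_image hF _. Qed.

Lemma computable_in_minus1 p q : minus1 p = Some q -> computable_in p q.
Proof. exact: computable_in_image computable_minus1. Qed.

Definition diagonal (p : baire) : baire := fun n =>
  oapp S 0 (partial_of_rel (fun n y =>
    exists2 e, program_code e = n & computes p e [:: n] y) n).

(** At its own code a program for the diagonal would output the successor of its output. *)
Lemma diagonal_not_computable p : ~ computable_in p (diagonal p).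
Proof.
move=> [e he]; have := he (program_code e).
rewrite {1}/diagonal /partial_of_rel; case: pselect => [h|[]]; last first.
  by exists (diagonal p (program_code e)), e.
case: (cid h) => y hy /=; case: hy => e' /program_code_inj -> hy /(computes_det hy).
exact: n_Sn.
Qed.

(** * Problems with one instance and one solution *)

Definition singleton_rep (a : baire) (p : baire) : option unit :=
  if pselect (p = a) is left _ then Some tt else None.

Lemma singleton_rep_surj a x : exists p, singleton_rep a p = Some x.
Proof. by exists a; rewrite /singleton_rep; case: pselect x => [_ []|[]]. Qed.

Definition singleton_space (a : baire) : repspace :=
  RepSpace (Representation (@singleton_rep_surj a)).

Lemma singleton_repP a p x : delta (singleton_space a) p = Some x -> p = a.
Proof. by rewrite /= /singleton_rep; case: pselect. Qed.

Lemma singleton_repE a : delta (singleton_space a) a = Some tt.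
Proof. by rewrite /= /singleton_rep; case: pselect => // -[]. Qed.

Definition transform (a b : baire) : problem :=
  @Problem (singleton_space a) (singleton_space b) (fun _ => setT).

Lemma sol_transform a b dX p q :
  minus1 q = Some b -> @sol (transform a b) dX (wp _) p q.
Proof. by move=> qb x _ _; exists tt; rewrite // wpE qb; exact: singleton_repE. Qed.

Lemma sol_transform_minus1 a b q :
  @sol (transform a b) (delta _) (wp _) a q -> minus1 q = Some b.
Proof.
move=> /(_ tt (singleton_repE a)) [|y]; first by exists tt.
by rewrite wpE; case: (minus1 q) => [r|//] /singleton_repP ->.
Qed.

Lemma sol_wp_target f dX p q x :
  @sol f dX (wp (target f)) p q -> dX p = Some x -> dom f x ->
  exists2 r, minus1 q = Some r & sol dX (delta (target f)) p r.
Proof.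
move=> h dx domx; have [y] := h _ dx domx; rewrite wpE.
case: (minus1 q) => [r|//] dr fxy; exists r => // x'; rewrite dx => -[<-] _.
by exists y.
Qed.

(** The left component of the answer hides [b] under two layers of padding: one of the outer
    representation, one of the completion. *)
Lemma sol_boxplus_inl a b g q :
  @sol (boxplus (transform a b) g) (wp _) (wp _) (S \o bcons 0 a) q -> computable_in q b.
Proof.
move=> solq; have [||r] := @sol_wp_target (boxplus (transform a b) g) _ _ _ (inl tt) solq.
- by rewrite wpE minus1_S; exact: (congr1 (omap inl) (singleton_repE a)).
- by exists (Some tt, None); exists tt.
move=> /computable_in_minus1 qr /sol_join /(_ _ (minus1_S _)) [/(_ erefl) + _].
move=> /sol_transform_minus1 /computable_in_minus1.
apply: computable_in_trans; apply: computable_in_trans qr _.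
exact: computable_in_fun computable_bfst.
Qed.

Lemma sol_boxplus_inr a b f q :
  @sol (boxplus f (transform a b)) (wp _) (wp _) (S \o bcons 1 a) q -> computable_in q b.
Proof.
move=> solq; have [||r] := @sol_wp_target (boxplus f (transform a b)) _ _ _ (inr tt) solq.
- by rewrite wpE minus1_S; exact: (congr1 (omap inr) (singleton_repE a)).
- by exists (None, Some tt); exists tt.
move=> /computable_in_minus1 qr /sol_join /(_ _ (minus1_S _)) [_ /(_ erefl)].
move=> /sol_transform_minus1 /computable_in_minus1.
apply: computable_in_trans; apply: computable_in_trans qr _.
exact: computable_in_fun computable_bsnd.
Qed.

Lemma sol_meet_transform f a b p q :
  sol (meet_source f (transform a b)) (meet_target f (transform a b))
    (bpair p (S \o a)) q ->
  exists2 s, minus1 q = Some s &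
    s 0 = 0 /\ sol (wp (source f)) (wp (target f)) p (btail s) \/
    s 0 = 1 /\ computable_in q b.
Proof.
move=> /sol_meet [s qs]; rewrite bfst_pair bsnd_pair => hs; exists s => //.
case: hs => -[s0 hs]; [by left | right; split=> //].
move: hs; rewrite (sol_wp_source _ _ (minus1_S _)).
move=> /sol_transform_minus1 /computable_in_minus1; apply: computable_in_trans.
apply: computable_in_trans (computable_in_minus1 qs) _.
exact: computable_in_fun computable_btail.
Qed.

Lemma sol_meet_inl f g p q :
  sol (wp (source f)) (wp (target f)) (bfst p) q ->
  sol (meet_source f g) (meet_target f g) p (S \o bcons 0 q).
Proof. by move=> h; apply/sol_meet; exists (bcons 0 q); [rewrite minus1_S | left]. Qed.

Lemma sol_meet_inr f g p q :
  sol (wp (source g)) (wp (target g)) (bsnd p) q ->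
  sol (meet_source f g) (meet_target f g) p (S \o bcons 1 q).
Proof. by move=> h; apply/sol_meet; exists (bcons 1 q); [rewrite minus1_S | right]. Qed.

Definition zeros : baire := fun=> 0.

(** The outer [S] pads the name of a point of the sum, the inner one the name of a point of the
    completion. *)
Lemma computable_tag c : computable_fun (fun p => S \o bcons c (S \o p)).
Proof.
apply: (@computable_fun_comp (fun p => bcons c (S \o p))) computable_bsucc.
exact: computable_bcons computable_bsucc.
Qed.

Lemma not_distributive_reduction (alpha beta gamma : baire) :
  ~ computable_in zeros alpha -> ~ computable_in alpha gamma ->
  ~ computable_in (bpair alpha gamma) beta ->
  let f := transform zeros alpha in let g := transform beta beta in
  let h := transform zeros gamma in
  ~ stW_le (meetp (boxplus f g) h) (boxplus (meetp f h) (meetp g h)).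
Proof.
move=> nalpha ngamma nbeta f g h.
have in_zeros r : computable_in r zeros by exact: computable_in_fun computable_const0.
have nzgamma : ~ computable_in zeros gamma.
  by move=> hz; apply: ngamma; exact: computable_in_trans hz.
have nabeta : ~ computable_in alpha beta.
  move=> ha; apply: nbeta; apply: computable_in_trans ha.
  by rewrite -{2}(bfst_pair alpha gamma); exact: computable_in_fun computable_bfst.
have nzbeta : ~ computable_in zeros beta.
  by move=> hz; apply: nabeta; exact: computable_in_trans hz.
move/(stW_leP (meet_source_variant _ _) (meet_target_variant _ _)
  (join_source_variant _ _) (join_target_variant _ _)) => -[H [K [hH hK HK]]].
have inH q : computable_in q (H q) by exact: computable_in_fun.
(* [p0] asks for [f] or [h], and [p1] for [g] or [h]; answers thus yield [alpha] or [gamma],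
   respectively [beta] or [gamma]. *)
pose p0 := bpair (S \o bcons 0 zeros) (S \o zeros).
pose p1 := bpair (S \o bcons 1 beta) (S \o zeros).
pose solN := sol (join_source (meetp f h) (meetp g h)) (join_target (meetp f h) (meetp g h)).
have out0 q : solN (K p0) q -> exists2 s, minus1 (H q) = Some s &
    s 0 = 0 /\ computable_in q alpha \/ s 0 = 1 /\ computable_in q gamma.
  move=> /HK /sol_meet_transform [s Hs hs]; exists s => //.
  case: hs => -[s0 hs]; [left | right]; split=> //; apply: (computable_in_trans (inH q)) => //.
  apply: computable_in_trans (computable_in_minus1 Hs) _.
  apply: computable_in_trans (computable_in_fun _ computable_btail) _.
  exact: sol_boxplus_inl hs.
have out1 q : solN (K p1) q -> exists2 s, minus1 (H q) = Some s &
    s 0 = 0 /\ computable_in q beta \/ s 0 = 1 /\ computable_in q gamma.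
  move=> /HK /sol_meet_transform [s Hs hs]; exists s => //.
  case: hs => -[s0 hs]; [left | right]; split=> //; apply: (computable_in_trans (inH q)) => //.
  apply: computable_in_trans (computable_in_minus1 Hs) _.
  apply: computable_in_trans (computable_in_fun _ computable_btail) _.
  exact: sol_boxplus_inr hs.
(* Each of these solves every instance on its side, through [alpha] as answer for [f] and [gamma] as
   answer for [h]. *)
pose a := S \o bcons 0 (S \o alpha); pose c := S \o bcons 1 (S \o gamma).
have solP_a p : sol (meet_source f h) (meet_target f h) p a.
  by apply: sol_meet_inl; apply: sol_transform; exact: minus1_S.
have solQ_c p : sol (meet_source g h) (meet_target g h) p c.
  by apply: sol_meet_inr; apply: sol_transform; exact: minus1_S.
have bad0 q : computable_in zeros q -> ~ solN (K p0) q.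
  move=> zq /out0 [s _ [[_ /(computable_in_trans zq)]|[_ /(computable_in_trans zq)]]].
    exact: nalpha.
  exact: nzgamma.
have bad1 q : computable_in alpha q -> ~ solN (K p1) q.
  move=> zq /out1 [s _ [[_ /(computable_in_trans zq)]|[_ /(computable_in_trans zq)]]].
    exact: nabeta.
  exact: ngamma.
(* Without a tag everything would solve [K p0]. With a nonzero tag the right side is a computable
   sequence, which cannot name the instance [beta] of [g], so a computable answer would do; this
   contradicts [bad0]. *)
have K0 : exists2 s, minus1 (K p0) = Some s & s 0 = 0.
  case E: (minus1 (K p0)) => [s|]; last first.
    by case: (bad0 zeros) => //; apply/sol_join; rewrite E.
  exists s => //; case s0: (s 0) => [//|k]; exfalso.
  apply: (bad0 (bpair zeros (S \o bcons 0 zeros))).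
    apply: (@computable_in_fun (fun p => bpair zeros (S \o bcons 0 zeros))).
    apply: computable_bpair; first exact: computable_const0.
    apply: (@computable_fun_comp (fun=> bcons 0 zeros)) computable_bsucc.
    exact: computable_bcons computable_const0.
  apply/sol_join => s'; rewrite E => -[<-]; split; first by rewrite s0.
  move=> _; rewrite bsnd_pair; apply: sol_meet_inl => x; rewrite wpE.
  case Es: (minus1 _) => [r|//] /singleton_repP er _; case: nzbeta.
  rewrite -er; apply: computable_in_trans (computable_in_minus1 Es).
  apply: computable_in_trans (computable_in_fun _ computable_bfst).
  apply: computable_in_trans (computable_in_fun _ computable_btail).
  apply: computable_in_trans (computable_in_minus1 E).
  apply: (@computable_in_fun (fun=> K p0)).
  apply: (@computable_fun_comp (fun=> p0)) hK.
  apply: (@computable_bpair (fun=> S \o bcons 0 zeros) (fun=> S \o zeros)).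
    apply: (@computable_fun_comp (fun=> bcons 0 zeros)) computable_bsucc.
    exact: computable_bcons computable_const0.
  exact: (@computable_fun_comp (fun=> zeros)) computable_const0 computable_bsucc.
(* If the right side were not asked for, the answer [a] on the left would suffice, and it is
   computable in [alpha]. *)
have K1 : exists2 s, minus1 (K p1) = Some s & s 0 = 1.
  have bad : ~ solN (K p1) (bpair a zeros).
    apply: bad1; apply: (@computable_in_fun (fun r => bpair (S \o bcons 0 (S \o r)) zeros)).
    by apply: computable_bpair; [exact: computable_tag | exact: computable_const0].
  case E: (minus1 (K p1)) => [s|]; last by case: bad; apply/sol_join; rewrite E.
  exists s => //; apply: contrapT => s0; apply: bad; apply/sol_join => s'.
  by rewrite E => -[<-]; split=> // _; rewrite bfst_pair; exact: solP_a.
case: K0 K1 => s0 Es0 s00 [s1 Es1 s10].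
have solN0 b : solN (K p0) (bpair a b).
  apply/sol_join => s; rewrite Es0 => -[<-]; rewrite s00; split=> // _.
  by rewrite bfst_pair; exact: solP_a.
have solN1 : solN (K p1) (bpair a c).
  apply/sol_join => s; rewrite Es1 => -[<-]; rewrite s10; split=> // _.
  by rewrite bsnd_pair; exact: solQ_c.
(* Tag 0 would make [beta] computable in the pair of [alpha] and [gamma]. *)
have [s Hs s_1] : exists2 s, minus1 (H (bpair a c)) = Some s & s 0 = 1.
  have [s Hs [[_ hb]|[]]] := out1 _ solN1; last by exists s.
  case: nbeta; apply: computable_in_trans hb.
  pose T r := bpair (S \o bcons 0 (S \o bfst r)) (S \o bcons 1 (S \o bsnd r)).
  have -> : bpair a c = T (bpair alpha gamma) by rewrite /T bfst_pair bsnd_pair.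
  apply: computable_in_fun.
  apply: computable_bpair.
    exact: computable_fun_comp computable_bfst (computable_tag 0).
  exact: computable_fun_comp computable_bsnd (computable_tag 1).
have [m hm] := computable_continuous 0 (computable_comp hH computable_minus1) Hs.
(* The right half is cut off after [m] entries and continued by zeros. This still solves [K p0],
   whose tag asks only for the left half, and it is computable in [alpha]; the unchanged tag 1 makes
   it compute [gamma]. *)
pose q := bpair a (nth 0 (mkseq c m)).
have agree_q : agree m (bpair a c) q.
  move=> i lt_im; rewrite /q /bpair; case: odd => //.
  by rewrite nth_mkseq //; apply: leq_ltn_trans lt_im; rewrite leq_half_double -addnn -addnS leq_addr.
have [s' Hs' hs'] := out0 _ (solN0 (nth 0 (mkseq c m))).
have := hm _ _ agree_q Hs'; rewrite s_1 => s'0.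
case: hs' => -[]; rewrite s'0 // => _ hg; apply: ngamma; apply: computable_in_trans hg.
apply: (@computable_in_fun (fun r => bpair (S \o bcons 0 (S \o r)) (nth 0 (mkseq c m)))).
by apply: computable_bpair; [exact: computable_tag | exact: computable_lookup].
Qed.

Theorem theorem6p7 :
  exists (d : Order.disp_t) (c : Order.Lattice.axioms_ d degree),
    let L : latticeType d := Order.Lattice.Pack c in
    [/\ forall f g : problem,
          ((deg f : L) <= (deg g : L))%O <-> stW_le f g,
        forall f g : problem,
          ((deg f : L) `&` (deg g : L))%O =
          deg (sqcap (completion_problem f) (completion_problem g)),
        forall f g : problem,
          ((deg f : L) `|` (deg g : L))%O = deg (boxplus f g)
      & ~ left_distributive (@Order.meet d L) (@Order.join d L)].
Proof.
exists degree_display, (Order.Lattice.class (degree : latticeType _)) => L.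
split; [exact: leE_deg | exact: meetE_deg | exact: joinE_deg | move=> distr].
(* Each sequence diagonalizes against what the corresponding hypothesis of
   [not_distributive_reduction] takes as oracle. *)
pose alpha := diagonal zeros; pose gamma := diagonal alpha.
pose beta := diagonal (bpair alpha gamma).
apply: (@not_distributive_reduction alpha beta gamma); try exact: diagonal_not_computable.
set f := transform zeros alpha; set g := transform beta beta.
set h := transform zeros gamma.
have := distr (deg f) (deg g) (deg h).
rewrite [X in Order.meet X _ = _]joinE_deg [X in _ = Order.join X _]meetE_deg.
rewrite [X in _ = Order.join _ X]meetE_deg [LHS]meetE_deg [RHS]joinE_deg.
(* One half of the resulting equivalence is the excluded reduction. *)
by case/deg_eq.
Qed.
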